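(* A ring $A$ is a right distributive, left Noetherian, centrally essential ring if and only if $A=A_1\times\cdots\times A_n$ for some positive integer $n$, where each $A_i$ ($i=1,\ldots,n$) is either a uniserial Artinian centrally essential ring or a commutative Dedekind domain. Moreover, in this case $A$ is a distributive Noetherian ring.
   Context: All rings are associative with a non-zero identity element. A ring $A$ with center $C$ is centrally essential if for every non-zero $a\in A$ there are non-zero central elements $c,d\in C$ with $ac=d$ (equivalently, the module $A_C$ is an essential extension of $C_C$). A module is distributive if the lattice of its submodules is distributive; a module is uniserial if any two of its submodules are comparable with respect to inclusion. A ring $A$ is right (left) distributive, right (left) uniserial, right (left) Noetherian or right (left) Artinian if the module $A_A$ (respectively ${}_AA$) has the corresponding property. A ring is called distributive, uniserial, Noetherian or Artinian (without a side) if both modules $A_A$ and ${}_AA$ have the corresponding property. *)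

(* Defs.v *)
From HB Require Import structures.
From mathcomp Require Import all_boot all_order all_algebra.
From mathcomp Require Import boolp classical_sets.

Set Implicit Arguments.
Unset Strict Implicit.
Unset Printing Implicit Defensive.

Import GRing.Theory.
Local Open Scope classical_set_scope.
Local Open Scope ring_scope.

Section Modules.
Variables (R : nzRingType) (V : lmodType R).

Definition submodule (I : set V) : Prop := GRing.submod_closed (mem I).

Definition submodule_add (I J : set V) : set V :=
  [set x + y | x in I & y in J].

Definition distributive_module : Prop :=
  forall I J K : set V, submodule I -> submodule J -> submodule K ->
    I `&` submodule_add J K = submodule_add (I `&` J) (I `&` K).

Definition uniserial_module : Prop :=
  forall I J : set V, submodule I -> submodule J -> I `<=` J \/ J `<=` I.

Definition noetherian_module : Prop :=
  forall I : nat -> set V, (forall n, submodule (I n)) ->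
    (forall n, I n `<=` I n.+1) ->
    exists N, forall n, (N <= n)%N -> I n = I N.

Definition artinian_module : Prop :=
  forall I : nat -> set V, (forall n, submodule (I n)) ->
    (forall n, I n.+1 `<=` I n) ->
    exists N, forall n, (N <= n)%N -> I n = I N.

End Modules.

Arguments distributive_module {R} V.
Arguments uniserial_module {R} V.
Arguments noetherian_module {R} V.
Arguments artinian_module {R} V.

(* The left module of A over itself is A^o; since lmodType only covers left
   modules, the right module of A over itself is the regular left module of
   the converse ring A^c, in which a *: x is the product x * a of A. *)
Definition left_regular (A : nzRingType) : lmodType A := A^o.
Definition right_regular (A : nzRingType) : lmodType A^c := (A^c)^o.

Definition right_distributive_ring (A : nzRingType) : Prop :=
  distributive_module (right_regular A).
Definition left_distributive_ring (A : nzRingType) : Prop :=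
  distributive_module (left_regular A).
Definition distributive_ring (A : nzRingType) : Prop :=
  right_distributive_ring A /\ left_distributive_ring A.

Definition right_uniserial_ring (A : nzRingType) : Prop :=
  uniserial_module (right_regular A).
Definition left_uniserial_ring (A : nzRingType) : Prop :=
  uniserial_module (left_regular A).
Definition uniserial_ring (A : nzRingType) : Prop :=
  right_uniserial_ring A /\ left_uniserial_ring A.

Definition right_noetherian_ring (A : nzRingType) : Prop :=
  noetherian_module (right_regular A).
Definition left_noetherian_ring (A : nzRingType) : Prop :=
  noetherian_module (left_regular A).
Definition noetherian_ring (A : nzRingType) : Prop :=
  right_noetherian_ring A /\ left_noetherian_ring A.

Definition right_artinian_ring (A : nzRingType) : Prop :=
  artinian_module (right_regular A).
Definition left_artinian_ring (A : nzRingType) : Prop :=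
  artinian_module (left_regular A).
Definition artinian_ring (A : nzRingType) : Prop :=
  right_artinian_ring A /\ left_artinian_ring A.

Definition ring_center (A : nzRingType) : set A :=
  [set c | forall x : A, GRing.comm c x].

Definition centrally_essential (A : nzRingType) : Prop :=
  forall a : A, a <> 0 ->
    exists c d : A, [/\ ring_center c, ring_center d, c <> 0, d <> 0 & a * c = d].

Definition integrally_closed (D : idomainType) : Prop :=
  forall z : {fraction D}, integralOver (@tofrac D) z ->
    exists x : D, z = tofrac x.

(* Dimension at most 1, so that fields are allowed; [idealr_closed] contains
   properness. *)
Definition nonzero_primes_maximal (D : idomainType) : Prop :=
  forall P : set D, idealr_closed (mem P) -> prime_idealr_closed (mem P) ->
    (exists2 x, P x & x <> 0) ->
    forall J : set D, idealr_closed (mem J) -> P `<=` J -> J = P.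

Definition dedekind_domain (D : idomainType) : Prop :=
  [/\ noetherian_ring D, integrally_closed D & nonzero_primes_maximal D].

(* An [idomainType] carries commutativity and a chosen inverse as structure;
   for a ring, being a commutative domain is having such a structure, which is
   expressed up to ring isomorphism. *)
Definition commutative_dedekind_domain (A : nzRingType) : Prop :=
  exists2 D : idomainType, dedekind_domain D &
    exists f : {rmorphism D -> A}, bijective f.

Definition ring_product (A : nzRingType) (n : nat)
    (B : 'I_n -> nzRingType) : Prop :=
  exists f : forall i, {rmorphism A -> B i},
    bijective (fun (a : A) (i : 'I_n) => f i a).

(* Main.v *)
From HB Require Import structures.
Require Import Defs.
From mathcomp Require Import all_boot all_order all_algebra ring.
From mathcomp Require Import boolp classical_sets.

(** Why the theorem holds. Right distributivity is used only through
    Stephenson's criterion ([left_distributiveP], read in the converse ring):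
    for all [x], [y] there is [a] with [x a] in [y A] and [y (1 - a)] in [x A].

    In a centrally essential ring idempotents are central, so a left Noetherian
    one is a finite product of rings without nontrivial idempotents, each of
    which inherits the hypotheses ([primitive_factor], [decomposition]). Let [A]
    be such an indecomposable ring. For a central [c], a power [d] of [c] has
    [dA] and [ann d] independent; the criterion turns [ann d] into an ideal
    generated by an idempotent, so [c] is regular or nilpotent
    ([central_regular_or_nilpotent]).

    If all nonzero central elements are regular, then every nonzero element has a
    regular central multiple, which makes [A] a commutative domain; a
    distributive Noetherian domain is a Dedekind domain.

    Otherwise there is a nonzero nilpotent central element, and every central
    element is nilpotent or invertible ([center_local]). The elements killed by
    all nilpotent central elements form an ideal [S] contained in the center, so
    commutators annihilate [S], and the annihilator [Q] of [S] is nilpotent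
    ([socle_ann_nilp]). Let [N] be a maximal nilpotent ideal containing [Q].
    Modulo [N] the ring is commutative and reduced; lifting idempotents makes [N]
    prime. An element [f] outside [N] divides all of [N] on the left, and the
    ascending chain condition forces it to be invertible ([nilradical_local]), so
    [A] is local. The criterion then gives [N = pA]. If [p ^ k] is the last
    nonzero power of [p], it is central by central essentiality, and comparing
    [u p ^ k] with [p ^ k u] shows [N = Ap] ([nilradical_generator_left]). All
    one-sided ideals are therefore powers of [N], and [A] is uniserial and
    Artinian.

    Conversely, in a uniserial Artinian ring the radical is nilpotent and
    generated on either side by one element ([uniserial_artinian_generator]),
    which gives both Noetherian conditions. A Dedekind domain satisfies the
    criterion because each maximal ideal is locally principal
    ([maximal_locally_principal], [dedekind_ldist]). All these properties pass to
    finite products. *)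

Set Implicit Arguments.
Unset Strict Implicit.
Unset Printing Implicit Defensive.

Import GRing.Theory.
Local Open Scope ring_scope.


(** * Left ideals and chain conditions *)

Definition lideal (A : nzRingType) (I : set A) : Prop :=
  [/\ I 0, forall x y, I x -> I y -> I (x + y) & forall a x, I x -> I (a * x)].

Lemma submoduleP (A : nzRingType) (I : set A) :
  submodule (I : set (left_regular A)) <-> lideal I.
Proof.
rewrite /submodule /GRing.submod_closed /GRing.linear_closed; split.
- rewrite inE => -[I0 IL].
  have {}IL a x y : I x -> I y -> I (a * x + y).
    by move=> Ix Iy; have := IL a x y; rewrite !inE; apply.
  split=> // [x y Ix Iy|a x Ix]; first by rewrite -[x]mul1r; exact: IL.
  by rewrite -[_ * _]addr0; exact: IL.
- case=> I0 ID IM; split; first by rewrite inE.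
  by move=> a x y; rewrite !inE => Ix Iy; apply: ID => //; apply: IM.
Qed.

Lemma lidealN (A : nzRingType) (I : set A) x : lideal I -> I x -> I (- x).
Proof. by case=> _ _ IM Ix; rewrite -mulN1r; exact: IM. Qed.

Lemma lidealB (A : nzRingType) (I : set A) x y :
  lideal I -> I x -> I y -> I (x - y).
Proof. by move=> hI Ix Iy; case: (hI) => _ ID _; apply: ID => //; exact: lidealN. Qed.

Lemma lideal_sub (A : nzRingType) (I : set A) x y :
  lideal I -> I (x - y) -> I y -> I x.
Proof. by case=> _ ID _ Ixy Iy; rewrite -(subrK y x); exact: ID. Qed.

Lemma lideal_principal (A : nzRingType) (x : A) :
  lideal [set z | exists a, z = a * x].
Proof.
split=> [|_ _ [a ->] [b ->]|a _ [b ->]]; first by exists 0; rewrite mul0r.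
  by exists (a + b); rewrite mulrDl.
by exists (a * b); rewrite mulrA.
Qed.

Lemma lideal_ann (A : nzRingType) (x : A) : lideal [set z | z * x = 0].
Proof.
split=> [|y z /= hy hz|a y /= hy]; first exact: mul0r.
  by rewrite mulrDl hy hz addr0.
by rewrite -mulrA hy mulr0.
Qed.

(** Both chain conditions enter through this form: a family of submodules,
    indexed so that the index can keep track of a witness, has a member that is
    extremal for the order [le]. *)
Lemma chain_extremal (V T : Type) (ok : set V -> Prop) (le : set V -> set V -> Prop)
    (X : T -> Prop) (L : T -> set V) :
  (forall I : nat -> set V, (forall n, ok (I n)) ->
     (forall n, le (I n) (I n.+1)) ->
     exists N, forall n, (N <= n)%N -> I n = I N) ->
  (forall t, X t -> ok (L t)) -> (exists t, X t) ->
  exists2 t, X t & forall t', X t' -> le (L t) (L t') -> L t' = L t.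
Proof.
move=> chain okL [t0 Xt0]; apply: contrapT => noext.
have next (s : {t | X t}) :
    {s' : {t | X t} | le (L (sval s)) (L (sval s')) /\ L (sval s') <> L (sval s)}.
  apply: cid; case: s => t Xt /=; apply: contrapT => stop.
  apply: noext; exists t => // t' Xt' tt'; apply: contrapT => neq.
  by apply: stop; exists (exist _ t' Xt').
pose s n := iter n (fun s => sval (next s)) (exist _ t0 Xt0).
have [N stab] := chain (fun n => L (sval (s n)))
  (fun n => okL _ (proj2_sig (s n))) (fun n => proj1 (proj2_sig (next (s n)))).
by case: (proj2_sig (next (s N))) => _ []; exact: stab N.+1 (leqnSn N).
Qed.

Lemma noetherian_maximal (A : nzRingType) (T : Type) (X : T -> Prop)
    (L : T -> set A) :
  left_noetherian_ring A -> (forall t, X t -> lideal (L t)) ->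
  (exists t, X t) ->
  exists2 t, X t &
    forall t', X t' -> (L t `<=` L t' -> L t' `<=` L t)%classic.
Proof.
move=> noethA idL ex.
have [t Xt maxt] := @chain_extremal _ _ _ _ X L noethA
  (fun t Xt => proj2 (submoduleP _) (idL t Xt)) ex.
by exists t => // t' Xt' tt'; rewrite (maxt _ Xt' tt').
Qed.

Lemma artinian_minimal (A : nzRingType) (T : Type) (X : T -> Prop)
    (L : T -> set A) :
  left_artinian_ring A -> (forall t, X t -> lideal (L t)) ->
  (exists t, X t) ->
  exists2 t, X t &
    forall t', X t' -> (L t' `<=` L t -> L t `<=` L t')%classic.
Proof.
move=> artA idL ex.
have [t Xt mint] := @chain_extremal _ _ _
  (fun I J => J `<=` I)%classic X L artA
  (fun t Xt => proj2 (submoduleP _) (idL t Xt)) ex.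
by exists t => // t' Xt' tt'; rewrite (mint _ Xt' tt').
Qed.

(** * Distributivity as a condition on pairs of elements *)

Definition ldist (A : nzRingType) : Prop := forall x y : A,
  exists a u v, a * x = u * y /\ (1 - a) * y = v * x.

(** Stephenson's criterion: decompose [x + y] inside [A(x + y)] along
    [Ax + Ay]; conversely the coefficients [a] and [1 - a] split any element
    [x + y] of an intersection into the two required parts. *)
Lemma left_distributiveP (A : nzRingType) : left_distributive_ring A <-> ldist A.
Proof.
split=> [distA x y|elt I J K /submoduleP hI /submoduleP hJ /submoduleP hK].
  pose P (z : A) : set A := [set w : A | exists a, w = a * z]%classic.
  have idP z : submodule (P z : set (left_regular A)) by apply/submoduleP; exact: lideal_principal.
  have : (P (x + y) `&` submodule_add (P x : set (left_regular A)) (P y))%classic (x + y).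
    split; first by exists 1; rewrite mul1r.
    by exists x; [exists 1; rewrite mul1r|exists y => //; exists 1; rewrite mul1r].
  rewrite (distA _ _ _ (idP _) (idP _) (idP _)).
  case=> _ [[b ->] [b' eb]] [_ [[c ->] [c' ec]]] exy.
  exists c, (c' - c), (b' - b - (1 - b - c)).
  have cx : c * x = (c' - c) * y.
    by rewrite mulrBl -ec mulrDr addrK.
  have b_y : b * y = (b' - b) * x.
    by rewrite mulrBl -eb mulrDr addrAC subrr add0r.
  split=> //.
  have /eqP : (1 - b - c) * (x + y) = 0.
    by rewrite !mulrBl mul1r -addrA -opprD exy subrr.
  rewrite mulrDr addr_eq0 => /eqP e.
  have -> : 1 - c = b + (1 - b - c) by rewrite [RHS]addrA [b + _]addrCA subrr addr0.
  by rewrite mulrDl b_y [RHS]mulrBl e opprK.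
apply/seteqP; split=> z /=.
  case=> Iz [x Jx [y Ky exy]].
  have [a [u [v [ax ay]]]] := elt x y.
  have [_ JD JM] := hJ; have [_ KD KM] := hK; have [_ ID IM] := hI.
  have xE : (1 - a) * z = (1 - a) * x + v * x by rewrite -exy mulrDr ay.
  have yE : a * z = u * y + a * y by rewrite -exy mulrDr ax.
  exists ((1 - a) * z); first by split; [exact: IM|rewrite xE; apply: JD; exact: JM].
  exists (a * z); first by split; [exact: IM|rewrite yE; apply: KD; exact: KM].
  by rewrite -mulrDl subrK mul1r.
case=> x [Ix Jx] [y [Iy Ky] <-]; split; last by exists x => //; exists y.
by case: hI => _ ID _; exact: ID.
Qed.

(** * Rings whose left ideals are the powers of one nilpotent element *)

Lemma noninc_stationary (g : nat -> nat) :
  (forall n, g n.+1 <= g n)%N -> exists N, forall n, (N <= n)%N -> g n = g N.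
Proof.
move=> dec.
have decD m n : (m <= n)%N -> (g n <= g m)%N.
  elim: n => [|n IHn]; first by rewrite leqn0 => /eqP ->.
  rewrite leq_eqVlt => /predU1P[-> //|/IHn]; exact: leq_trans (dec n).
have ex : exists v, `[< exists n, g n = v >] by exists (g 0); apply/asboolP; exists 0.
case: (ex_minnP ex) => v /asboolP[N <-] minN; exists N => n Nn.
apply/eqP; rewrite eqn_leq decD //=; apply: minN; apply/asboolP; by exists n.
Qed.

Section PowerChain.
Variables (A : nzRingType) (p : A) (n : nat).
Hypotheses (pn0 : p ^+ n = 0)
  (unit_or_mul : forall x : A, (exists v, v * x = 1) \/ (exists y, x = y * p)).

(** Divide by [p] on the right until the cofactor is a unit, which happens
    before the power reaches [p ^ n = 0] unless [x = 0]. *)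
Lemma power_factor (x : A) :
  exists i u v, x = u * p ^+ i /\ v * x = p ^+ i.
Proof.
have step k : (exists i u v, x = u * p ^+ i /\ v * x = p ^+ i) \/
    exists z, x = z * p ^+ k.
  elim: k => [|k [?|[z xz]]]; [by right; exists x; rewrite expr0 mulr1|by left|].
  case: (unit_or_mul z) => [[v vz]|[y zy]].
    by left; exists k, z, v; rewrite xz mulrA vz mul1r.
  by right; exists y; rewrite xz zy -mulrA -exprS.
case: (step n) => // -[z]; rewrite pn0 mulr0 => ->.
by exists n, 0, 1; rewrite pn0 !mulr0.
Qed.

Lemma lideal_power (I : set A) : lideal I ->
  exists j, forall x, I x <-> exists y, x = y * p ^+ j.
Proof.
move=> [I0 ID IM].
have ex : exists j, `[< I (p ^+ j) >] by exists n; apply/asboolP; rewrite pn0.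
case: (ex_minnP ex) => j /asboolP Ij minj.
exists j => x; split=> [Ix|[y ->]]; last exact: IM.
have [i [u [v [xE vx]]]] := power_factor x.
have ji : (j <= i)%N by apply: minj; apply/asboolP; rewrite -vx; exact: IM.
by exists (u * p ^+ (i - j)); rewrite -mulrA -exprD subnK.
Qed.

Lemma lideal_power_sub i j : (i <= j)%N ->
  ([set x | exists y, x = y * p ^+ j] `<=` [set x | exists y, x = y * p ^+ i])%classic.
Proof.
by move=> ij _ [y ->] /=; exists (y * p ^+ (j - i)); rewrite -mulrA -exprD subnK.
Qed.

Lemma power_left_uniserial : left_uniserial_ring A.
Proof.
move=> I J /submoduleP /lideal_power[i Ii] /submoduleP /lideal_power[j Jj].
have [ij|/ltnW ji] := leqP i j; [right|left] => x.
  by move/Jj/(lideal_power_sub ij)/Ii.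
by move/Ii/(lideal_power_sub ji)/Jj.
Qed.

(** A chain of left ideals is a chain of exponents between [0] and [n]; taking
    the least exponent occurring makes it monotone along the chain. *)
Lemma power_chain (I : nat -> set A) : (forall k, lideal (I k)) ->
  exists2 g : nat -> nat, (forall k, (g k <= n)%N) &
    (forall k l, (I k `<=` I l)%classic -> (g l <= g k)%N) /\
    (forall k l, g k = g l -> I k = I l).
Proof.
move=> idI.
have ex k : exists j, `[< I k (p ^+ j) >].
  exists n; apply/asboolP; rewrite pn0; by case: (idI k).
pose g k := ex_minn (ex k).
have gP k : I k (p ^+ g k) by rewrite /g; case: ex_minnP => j /asboolP.
have gmin k j : I k (p ^+ j) -> (g k <= j)%N.
  by move=> Ij; rewrite /g; case: ex_minnP => i _; apply; apply/asboolP.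
have IE k : I k = [set x | exists y, x = y * p ^+ g k]%classic.
  have [j jP] := lideal_power (idI k).
  apply/seteqP; split=> x; last by case=> y ->; case: (idI k) => _ _; exact.
  move=> /jP; apply: lideal_power_sub; apply: gmin; apply/jP.
  by exists 1; rewrite mul1r.
exists g => [k|]; first by apply: gmin; rewrite pn0; case: (idI k).
by split=> [k l kl|k l kl]; [apply: gmin; exact: kl|rewrite !IE kl].
Qed.

Lemma power_left_noetherian : left_noetherian_ring A.
Proof.
move=> I idI incI.
have [g _ [gle geq]] := power_chain (fun k => proj1 (submoduleP _) (idI k)).
have [N stab] := noninc_stationary (fun k => gle _ _ (incI k)).
by exists N => k Nk; apply: geq; exact: stab.
Qed.

Lemma power_left_artinian : left_artinian_ring A.
Proof.
move=> I idI decI.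
have [g gn [gle geq]] := power_chain (fun k => proj1 (submoduleP _) (idI k)).
have [k|N stab] := @noninc_stationary (fun k => n - g k)%N.
  by apply: leq_sub2l; apply: gle; exact: decI.
exists N => k Nk; apply: geq; have := stab k Nk.
by rewrite -{2}(subKn (gn k)) -{2}(subKn (gn N)) => ->.
Qed.

End PowerChain.

(** * Nilpotent ideals *)

Definition ideal (A : nzRingType) (J : set A) : Prop :=
  lideal J /\ forall x a, J x -> J (x * a).

(** Products of [n] factors from [J]. The value at [0] is the whole ring rather
    than [1], so that every value is stable under multiplication as soon as [J]
    is an ideal. *)
Fixpoint products (A : nzRingType) (J : set A) (n : nat) : set A :=
  if n is m.+1 then [set z | exists y j, [/\ products J m y, J j & z = y * j]]%classic
  else setT.

Definition nilpotent_set (A : nzRingType) (J : set A) : Prop :=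
  exists n, forall y, products J n y -> y = 0.

Definition isunit (A : nzRingType) (x : A) : Prop :=
  exists y, y * x = 1 /\ x * y = 1.

Section Nilpotent.
Variables (A : nzRingType) (J : set A).
Hypothesis idJ : ideal J.

Lemma products_mulr n x a : products J n x -> products J n (x * a).
Proof.
case: n => //= n [y [j [hy Jj ->]]]; exists y, (j * a); split=> //.
  by case: idJ => _; exact.
by rewrite mulrA.
Qed.

Lemma products_exp n x : J x -> products J n (x ^+ n).
Proof. by move=> Jx; elim: n => //= n IHn; exists (x ^+ n), x; rewrite exprSr. Qed.

Lemma nilp_exp : nilpotent_set J -> exists n, forall x, J x -> x ^+ n = 0.
Proof. by case=> n hn; exists n => x Jx; apply: hn; exact: products_exp. Qed.

(** If every element of [J] were a product of two elements of [J], it would be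
    a product of arbitrarily many. *)
Lemma nilp_irreducible : nilpotent_set J ->
  exists2 p, J p & (forall x, J x -> x = 0) \/ (forall x y, J x -> J y -> p <> x * y).
Proof.
move=> [n hn]; apply: contrapT => nop.
have split2 x : J x -> exists y z, [/\ J y, J z & x = y * z].
  move=> Jx; apply: contrapT => irr; apply: nop; exists x => //; right=> y z Jy Jz e.
  by apply: irr; exists y, z.
have all_products k x : J x -> products J k x.
  elim: k x => //= k IHk x Jx; have [y [z [Jy Jz ->]]] := split2 x Jx.
  by exists y, z; split=> //; exact: IHk.
by apply: nop; exists 0; [case: idJ => -[]|left=> x /(all_products n)/hn].
Qed.

End Nilpotent.

Lemma geometric_sum (A : nzRingType) (x : A) n :
  (1 - x) * (\sum_(i < n) x ^+ i) = 1 - x ^+ n /\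
  (\sum_(i < n) x ^+ i) * (1 - x) = 1 - x ^+ n.
Proof.
have e : (1 - x) * (\sum_(i < n) x ^+ i) = 1 - x ^+ n.
  by rewrite -opprB mulNr -subrX1 opprB.
split=> //; rewrite -e; apply/esym/commr_sum => i _.
by apply/commr_sym/commrB; [exact: commr1|apply/commr_sym/commrX].
Qed.

Lemma exp0_unit (A : nzRingType) (x : A) n : x ^+ n = 0 -> isunit (1 - x).
Proof.
move=> xn; have [l r] := geometric_sum x n.
by exists (\sum_(i < n) x ^+ i); rewrite l r xn subr0.
Qed.

(** * Uniserial Artinian rings *)

Section UniserialArtinian.
Variable A : nzRingType.
Hypotheses (uniL : left_uniserial_ring A) (uniR : right_uniserial_ring A)
  (artL : left_artinian_ring A).

Lemma left_comparable (x y : A) : (exists a, x = a * y) \/ (exists a, y = a * x).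
Proof.
have idP z := proj2 (submoduleP [set w : A | exists a, w = a * z]%classic)
  (lideal_principal z).
by case: (uniL (idP x) (idP y)) => h; [left|right]; apply: h; exists 1; rewrite mul1r.
Qed.

Definition nonunits : set A := [set x | ~ exists y, y * x = 1]%classic.

Lemma nonunits_lideal : lideal nonunits.
Proof.
have mull a x : nonunits x -> nonunits (a * x).
  by move=> nx [y yax]; apply: nx; exists (y * a); rewrite -mulrA.
split=> [[y]||//]; first by rewrite mulr0 => /esym/eqP; rewrite oner_eq0.
move=> x y nx ny; case: (left_comparable x y) => -[a ->].
  by rewrite -[X in _ + X]mul1r -mulrDl; exact: mull.
by rewrite -[X in X + _]mul1r -mulrDl; exact: mull.
Qed.

Lemma nonunits_sub1 x : nonunits x -> exists y, y * (1 - x) = 1.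
Proof.
move=> nx; apply: contrapT => n1x; have [_ nD _] := nonunits_lideal.
by apply: (nD _ _ n1x nx); exists 1; rewrite subrK mul1r.
Qed.

(** The idempotent [x y] or its complement has a left inverse, so [x y] is [1] or
    [0], and [0] is excluded by [y (x y) x = 1]. *)
Lemma left_inverse_right (x y : A) : y * x = 1 -> x * y = 1.
Proof.
move=> yx; have idem : x * y * (x * y) = x * y by rewrite mulrA -(mulrA x) yx mulr1.
case: (pselect (exists z, z * (x * y) = 1)) => [[z ze]|/nonunits_sub1[z ze]].
  have : z * (x * y) * (x * y - 1) = 0 by rewrite -mulrA mulrBr idem mulr1 subrr mulr0.
  by rewrite ze mul1r => /eqP; rewrite subr_eq0 => /eqP.
have xy0 : x * y = 0.
  by rewrite -[x * y]mul1r -ze -mulrA mulrBl mul1r idem subrr mulr0.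
have := mul1r (1 : A); rewrite -{1 2}yx -mulrA (mulrA x) xy0 mul0r mulr0.
by move/esym/eqP; rewrite oner_eq0.
Qed.

Lemma nonunits_ideal : ideal nonunits.
Proof.
split=> [|x a nx [y yxa]]; first exact: nonunits_lideal.
by apply: nx; exists (a * y); rewrite -mulrA; apply: left_inverse_right; rewrite -mulrA.
Qed.

Lemma nonunitsPn x : ~ nonunits x -> isunit x.
Proof. by move/contrapT=> [y yx]; exists y; split=> //; exact: left_inverse_right. Qed.

(** Comparability of the last factors makes a sum of two products a product, so
    the [products nonunits n] form a descending chain of left ideals. Where it stops,
    a minimal [Ax] not killed by [products nonunits n] gives [x = a j x] with [j]
    in the radical, hence [x = 0]. *)
Lemma nonunits_nilp : nilpotent_set nonunits.
Proof.
have idJ := nonunits_ideal; have [J0 JD JM] := nonunits_lideal.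
have lid n : lideal (products nonunits n).
  elim: n => [|n [P0 PD PM]] //=; split=> [|_ _ [x [j [hx Jj ->]]] [y [k [hy Jk ->]]]|].
  - by exists 0, 0; rewrite mulr0.
  - case: (left_comparable j k) => -[a e].
      exists (x * a + y), k; split=> //; last by rewrite e mulrDl mulrA.
      by apply: PD => //; exact: products_mulr.
    exists (x + y * a), j; split=> //; last by rewrite e mulrDl mulrA.
    by apply: PD => //; exact: products_mulr.
  - by move=> a _ [x [j [hx Jj ->]]]; exists (a * x), j; rewrite mulrA; split=> //; exact: PM.
have [N stab] : exists N, forall n, (N <= n)%N -> products nonunits n = products nonunits N.
  apply: (@artL (products nonunits)) => [n|n]; first by apply/submoduleP; exact: lid.
  by move=> _ [x [j [hx Jj ->]]]; exact: products_mulr.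
exists N; apply: contrapT => /existsNP[i /not_implyP[Pi i0]].
have [x [i' [Pi' ix]] minx] : exists2 x, (exists i, products nonunits N i /\ i * x <> 0) &
    forall x', (exists i, products nonunits N i /\ i * x' <> 0) ->
    ([set w | exists a, w = a * x'] `<=` [set w | exists a, w = a * x] ->
     [set w | exists a, w = a * x] `<=` [set w | exists a, w = a * x'])%classic.
  apply: artinian_minimal => // [x _|]; first exact: lideal_principal.
  by exists 1, i; rewrite mulr1.
have : products nonunits N.+1 i' by rewrite stab.
case=> i'' [j [Pi'' Jj ei]].
have jx : exists i, products nonunits N i /\ i * (j * x) <> 0.
  by exists i''; rewrite mulrA -ei.
have sub : ([set w | exists a, w = a * (j * x)] `<=` [set w | exists a, w = a * x])%classic.
  by move=> _ [a ->]; exists (a * j); rewrite mulrA.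
have [|a xa] := minx _ jx sub x; first by exists 1; rewrite mul1r.
have [y ya] := nonunits_sub1 (JM a _ Jj).
apply: ix; have -> : x = 0; last exact: mulr0.
by rewrite -[x]mul1r -ya -mulrA mulrBl mul1r -[a * j * x]mulrA -xa subrr mulr0.
Qed.

(** An irreducible element of the radical generates it on either side: any other
    element of the radical is a multiple of it, or divides it with a unit as
    cofactor. *)
Lemma uniserial_artinian_generator : exists (p : A) n, [/\ p ^+ n = 0,
  forall x, (exists v, v * x = 1) \/ (exists y, x = y * p) &
  forall x, (exists v, x * v = 1) \/ (exists y, x = p * y)].
Proof.
have [p Jp irr] := nilp_irreducible nonunits_ideal nonunits_nilp.
have [n hn] := nilp_exp nonunits_nilp.
exists p, n; split=> [|x|x]; first exact: hn.
- case: (pselect (nonunits x)) => [Jx|/nonunitsPn[v [vx _]]]; [right|by left; exists v].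
  case: irr => [J0|irr]; first by exists 0; rewrite mul0r (J0 _ Jx).
  case: (left_comparable x p) => // -[y py].
  have /nonunitsPn[z [zy _]] : ~ nonunits y by move=> Jy; exact: (irr y x).
  by exists z; rewrite py mulrA zy mul1r.
- case: (pselect (nonunits x)) => [Jx|/nonunitsPn[v [_ xv]]]; [right|by left; exists v].
  case: irr => [J0|irr]; first by exists 0; rewrite mulr0 (J0 _ Jx).
  have idP z := proj2 (submoduleP [set w : A^c | exists a, w = a * z]%classic)
    (lideal_principal (z : A^c)).
  case: (uniR (idP x) (idP p)) => h.
    by case: (h x) => [|y ->]; [exists 1; rewrite mul1r|exists y].
  case: (h p) => [|y py]; first by exists 1; rewrite mul1r.
  have {}py : p = (x : A) * y by [].
  have /nonunitsPn[z [_ yz]] : ~ nonunits y by move=> Jy; exact: (irr x y).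
  by exists z; rewrite py -mulrA yz mulr1.
Qed.

End UniserialArtinian.

Lemma exprc (A : nzRingType) (p : A) n : (p : A^c) ^+ n = (p ^+ n : A).
Proof. by elim: n => // n IHn; rewrite exprS IHn exprSr. Qed.

Lemma uniserial_artinian_noetherian (A : nzRingType) :
  uniserial_ring A -> artinian_ring A -> noetherian_ring A.
Proof.
move=> [uR uL] [_ aL].
have [p [n [pn hl hr]]] := uniserial_artinian_generator uL uR aL.
split; last exact: (power_left_noetherian pn).
by apply: (@power_left_noetherian A^c p n); rewrite ?exprc.
Qed.

(** * Noetherian domains, Dedekind domains and distributivity *)

Section NoetherianDomain.
Variable D : idomainType.
Hypothesis noethD : left_noetherian_ring D.

(** An element-wise form of Krull's intersection theorem and Nakayama's lemma:
    away from the multiplicative set [S], where [j] generates a proper ideal, an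
    [x] can be divided by [j] again and again only if some quotient vanishes,
    because otherwise the localized ideals generated by the quotients grow
    strictly. *)
Lemma division_chain_vanishes (S X : set D) (j : D) :
  S 1 -> (forall s t, S s -> S t -> S (s * t)) -> (forall d, ~ S (j * d)) ->
  (forall x, X x -> exists x' s, [/\ X x', S s & s * x = j * x']) ->
  (exists x, X x) -> X 0.
Proof.
move=> S1 SM Sj div exX.
have [|x Xx maxx] := @noetherian_maximal D D X
    (fun x => [set r | exists s d, S s /\ s * r = d * x]%classic) noethD _ exX.
  move=> x _; split=> [|r1 r2 [s1 [d1 [S1' e1]]] [s2 [d2 [S2 e2]]]|a r [s [d [Ss e]]]].
  - by exists 1, 0; rewrite mulr0 mul0r.
  - exists (s1 * s2), (s2 * d1 + s1 * d2); split; first exact: SM.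
    have -> : s1 * s2 * (r1 + r2) = s2 * (s1 * r1) + s1 * (s2 * r2) by ring.
    by rewrite e1 e2; ring.
  - by exists s, (a * d); split=> //; rewrite mulrCA e mulrA.
have [x' [t [Xx' St tx]]] := div x Xx.
have [||s [d [Ss e]]] := maxx x' Xx' _ x'.
- move=> r [s [d [Ss e]]]; exists (s * t), (d * j); split; first exact: SM.
  have -> : s * t * r = t * (s * r) by ring.
  by rewrite e mulrCA tx mulrA.
- by exists 1, 1; rewrite mul1r.
have [<-//|/eqP x'0] := pselect (x' = 0).
case: (Sj d); suff <- : s * t = j * d by exact: SM.
apply: (mulIf x'0); have -> : s * t * x' = t * (s * x') by ring.
by rewrite e mulrCA tx; ring.
Qed.

(** The elements [q(z) b] with [q] of size at most [n] form an ascending chain of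
    ideals; where it stops, [z ^ n b = q(z) b] is an integral equation for [z]. *)
Lemma almost_integral_integral (z : {fraction D}) (b : D) : b <> 0 ->
  (forall n, exists r, z ^+ n * tofrac b = tofrac r) ->
  integralOver (@tofrac D) z.
Proof.
move=> /eqP b0 almost.
have [||n _ maxn] := @noetherian_maximal D nat (fun=> True)
  (fun n => [set x | exists q : {poly D}, (size q <= n)%N /\
      tofrac x = (map_poly (@tofrac D) q).[z] * tofrac b]%classic) noethD.
- move=> n _; split=> [|x y [p [sp ep]] [q [sq eq]]|a x [p [sp ep]]].
  + by exists 0; rewrite size_poly0 tofrac0 map_poly0 horner0 mul0r.
  + exists (p + q); split; first by rewrite (leq_trans (size_polyD _ _)) // geq_max sp.
    by rewrite tofracD ep eq rmorphD hornerD mulrDl.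
  + exists (a *: p); split; first exact: leq_trans (size_scale_leq _ _) sp.
    by rewrite tofracM ep map_polyZ hornerZ mulrA.
- by exists 0%N.
have [r zr] := almost n.
have [x [q [sq eq]]||q [sq eq]] := maxn n.+1 I _ r.
- by exists q; split=> //; exact: leqW.
- exists 'X^n; rewrite size_polyXn map_polyXn hornerXn -zr; split=> //.
exists ('X^n - q).
  rewrite monicE lead_coefDl ?lead_coefXn // size_polyN size_polyXn ltnS //.
rewrite rootE rmorphB /= map_polyXn hornerD hornerN hornerXn subr_eq0.
by apply/eqP/(mulIf (_ : tofrac b != 0)); rewrite ?tofrac_eq0 // zr -eq.
Qed.

Section MaximalIdeal.
Variables (M : set D) (b : D).
Hypotheses (intD : integrally_closed D) (primeD : nonzero_primes_maximal D)
  (idM : lideal M) (M1 : ~ M 1)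
  (maxM : forall J, lideal J -> ~ J 1 -> (M `<=` J -> J `<=` M)%classic)
  (Mb : M b) (b0 : b <> 0).

Lemma maximal_prime u v : M (u * v) -> M u \/ M v.
Proof.
move=> Muv; have [M0 MD MM] := idM; have [Mu|nMu] := pselect (M u); [by left|right].
have [a Ma] : exists a, M (1 - a * u).
  apply: contrapT => no; apply: nMu.
  apply: (maxM (J := [set r | exists a, M (r - a * u)]%classic)) => //.
  - split=> [|x y [a Ma] [c Mc]|c x [a Ma]].
    + by exists 0; rewrite mul0r subr0.
    + by exists (a + c); rewrite (_ : _ - _ = x - a * u + (y - c * u)); [exact: MD|ring].
    + by exists (c * a); rewrite -mulrA -mulrBr; exact: MM.
  - by move=> r Mr; exists 0; rewrite mul0r subr0.
  - by exists 1; rewrite mul1r subrr.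
rewrite (_ : v = v * (1 - a * u) + a * (u * v)); last by ring.
by apply: MD; apply: MM.
Qed.

Lemma maximal_compl s t : ~ M s -> ~ M t -> ~ M (s * t).
Proof. by move=> Ms Mt /maximal_prime[]. Qed.

(** A colon ideal [(b : c)] that is as large as possible after localizing at
    [M], while proper there, is prime, hence equal to [M]. *)
Lemma colon_maximal : exists c,
  (forall r, M r -> exists d, c * r = d * b) /\ ~ exists d, c = d * b.
Proof.
have [M0 MD MM] := idM.
pose L c : set D := [set r | exists s d, ~ M s /\ s * r * c = d * b]%classic.
have idL c : lideal (L c).
  split=> [|r1 r2 [s1 [d1 [S1 e1]]] [s2 [d2 [S2 e2]]]|a r [s [d [Ss e]]]].
  - by exists 1, 0; rewrite mulr0 !mul0r.
  - exists (s1 * s2), (s2 * d1 + s1 * d2); split; first exact: maximal_compl.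
    have -> : s1 * s2 * (r1 + r2) * c = s2 * (s1 * r1 * c) + s1 * (s2 * r2 * c) by ring.
    by rewrite e1 e2; ring.
  - by exists s, (a * d); split=> //; rewrite -[a * d * b]mulrA -e; ring.
have [|c Lc1 maxc] := @noetherian_maximal D D (fun c => ~ L c 1) L noethD (fun c _ => idL c).
  exists 1 => -[s [d [Ms]]]; rewrite !mulr1 => sdb; apply: Ms; rewrite sdb; exact: MM.
have LM r : L c r -> M r.
  move=> [s [d [Ms e]]]; apply: contrapT => Mr; apply: Lc1.
  by exists (s * r), d; rewrite mulr1; split=> //; exact: maximal_compl.
have ML r : M r -> L c r.
  suff -> : M = L c by [].
  apply: primeD => //; [| |by exists b => //; exists 1, c; split=> //; ring|].
  - have [L0 LD LMu] := idL c; rewrite /idealr_closed !inE; split=> //.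
      by apply/negP; rewrite inE.
    by move=> a u v; rewrite !inE => Lu Lv; apply: LD => //; exact: LMu.
  - move=> u v; rewrite !inE => Luv; apply/orP; rewrite !inE.
    have [Lu|Lu] := pselect (L c u); [by left|right].
    apply: (maxc (u * c)).
    + by move=> [s [d [Ms e]]]; apply: Lu; exists s, d; split=> //; rewrite -e; ring.
    + by move=> t [s [d [Ms e]]]; exists s, (d * u); split=> //; ring: e.
    + by case: Luv => s [d [Ms e]]; exists s, d; split=> //; rewrite -e; ring.
  - by rewrite /idealr_closed !inE; split=> //; [apply/negP; rewrite inE|
      move=> a u v; rewrite !inE => Mu Mv; apply: MD => //; exact: MM].
(* One denominator [s] serves all of [M]: the one that clears as many elements
   as possible, since a product of denominators clears more. *)
have [||s Ms maxs] := @noetherian_maximal D D (fun s => ~ M s)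
    (fun s => [set r | exists d, s * r * c = d * b]%classic) noethD.
- move=> s _; split=> [|r1 r2 [d1 e1] [d2 e2]|a r [d e]].
  + by exists 0; rewrite mulr0 !mul0r.
  + by exists (d1 + d2); rewrite !mulrDl mulrDr mulrDl e1 e2.
  + by exists (a * d); ring: e.
- by exists 1.
exists (s * c); split=> [r Mr|[d e]]; last first.
  by apply: Lc1; exists s, d; rewrite mulr1.
have [t [d [Mt e]]] := ML r Mr.
have [||d' e'] := maxs (s * t) (maximal_compl Ms Mt) _ r.
- by move=> x [d' e']; exists (t * d'); ring: e'.
- by exists (s * d); ring: e.
by exists d'; ring: e'.
Qed.

(** With [c] as above, [c M] cannot stay inside [b M], for then [c / b] would
    be integral over [D]; so some [m] generates [M] locally. *)
Lemma maximal_locally_principal :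
  exists m w, [/\ M m, ~ M w & forall r, M r -> exists d, w * r = m * d].
Proof.
have [M0 MD MM] := idM.
have [c [cM cb]] := colon_maximal.
have [m [w [Mm Mw e]]] : exists m w, [/\ M m, ~ M w & c * m = w * b].
  apply: contrapT => no; apply: cb.
  have stay m : M m -> exists2 d, M d & c * m = d * b.
    move=> Mm; have [d e] := cM m Mm; exists d => //.
    by apply: contrapT => Md; apply: no; exists m, d.
  have fb0 : tofrac b != 0 by rewrite tofrac_eq0; apply/eqP.
  have [|x zx] := intD (z := tofrac c / tofrac b).
    apply: (almost_integral_integral b0) => n.
    suff [r Mr ->] : exists2 r, M r & (tofrac c / tofrac b) ^+ n * tofrac b = tofrac r.
      by exists r.
    elim: n => [|n [r Mr IHn]]; first by exists b => //; rewrite expr0 mul1r.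
    have [d Md e] := stay r Mr; exists d => //.
    by rewrite exprS -mulrA IHn mulrAC -tofracM e tofracM mulfK.
  exists x; apply/eqP; rewrite -tofrac_eq tofracM -zx mulfVK //.
exists m, w; split=> // r Mr; have [d e'] := cM r Mr; exists d.
apply: (mulIf (_ : b != 0)); first exact/eqP.
by rewrite mulrAC -e mulrAC e'; ring.
Qed.

End MaximalIdeal.

(** The criterion says that the ideal [E] of all [a + b] with [a x] in [Dy] and
    [b y] in [Dx] contains [1]. If [E] were contained in a maximal ideal [M], then
    [x] and [y] would both lie in [M], and dividing them by a local
    generator of [M] would produce another such pair, for ever. *)
Lemma dedekind_ldist : integrally_closed D -> nonzero_primes_maximal D -> ldist D.
Proof.
move=> intD primeD x y.
pose E : set D := [set e | exists a b u v, [/\ e = a + b, a * x = u * y & b * y = v * x]]%classic.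
suff [a [b [u [v [ab ax bY]]]]] : E 1 by exists a, u, v; rewrite ab addrAC subrr add0r.
have [x0|/eqP x0] := pselect (x = 0).
  by exists 1, 0, 0, 0; rewrite x0 mulr0 !mul0r addr0.
apply: contrapT => E1.
have idE : lideal E.
  split=> [|_ _ [a [b [u [v [-> ax bY]]]]] [a' [b' [u' [v' [-> ax' bY']]]]]|].
  - by exists 0, 0, 0, 0; rewrite !mul0r addr0.
  - exists (a + a'), (b + b'), (u + u'), (v + v').
    by rewrite !mulrDl ax ax' bY bY'; split=> //; ring.
  - move=> c _ [a [b [u [v [-> ax bY]]]]]; exists (c * a), (c * b), (c * u), (c * v).
    by rewrite mulrDr -!mulrA ax bY; split.
have [||M [idM M1 EM] maxM] := @noetherian_maximal D (set D)
    (fun M => [/\ lideal M, ~ M 1 & (E `<=` M)%classic]) id noethD.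
- by move=> M [].
- by exists E; split.
have {}maxM J : lideal J -> ~ J 1 -> (M `<=` J -> J `<=` M)%classic.
  by move=> idJ J1 MJ; apply: maxM => //; split=> // r /EM /MJ.
have Mx : M x by apply: EM; exists 0, x, 0, y; rewrite !mul0r add0r; split=> //; ring.
have [m [w [Mm Mw mw]]] :=
  maximal_locally_principal intD primeD idM M1 maxM Mx (elimN eqP x0).
have [M0 MD MM] := idM.
pose bad z t := ~ exists2 s, ~ M s & exists d, s * z = d * t \/ s * t = d * z.
pose X : set D := [set z | exists t, bad z t]%classic.
have [t] : X 0; last by case; exists 1 => //; exists 0; left; rewrite mulr0 mul0r.
have badxy : bad x y.
  move=> [s Ms [d [e|e]]]; apply: Ms; apply: EM.
    by exists s, 0, d, 0; rewrite addr0 !mul0r.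
  by exists 0, s, 0, d; rewrite add0r !mul0r.
apply: (@division_chain_vanishes (fun s => ~ M s) X m) => //; last by exists x, y.
- by move=> s t Ms Mt; exact: (maximal_compl idM maxM).
- by move=> d; rewrite mulrC; apply; exact: MM.
move=> z [t zt].
have Mz : M z by apply: contrapT => Mz; apply: zt; exists z => //; exists t; right; ring.
have Mt : M t by apply: contrapT => Mt; apply: zt; exists t => //; exists z; left; ring.
have [z' ez] := mw z Mz; have [t' et] := mw t Mt.
exists z', w; split=> //; exists t' => -[s Ms [d e]]; apply: zt.
exists (s * w); first exact: (maximal_compl idM maxM).
exists (d * w); case: e => e; [left|right].
  by rewrite -!mulrA ez et mulrCA e mulrCA.
by rewrite -!mulrA ez et mulrCA e mulrCA.
Qed.

(** If [z a] is in the ring and [1 - a = z v], an integral equation for [z], multiplied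
    by a power of [v], puts [z (1 - a) ^ n] into the ring, and [a], [(1 - a) ^ n]
    generate the unit ideal. *)
Lemma ldist_integrally_closed : ldist D -> integrally_closed D.
Proof.
move=> elt z [p mp rp].
pose f : D -> {fraction D} := @tofrac D.
have [x [y [y0 zE]]] : exists x y : D, y != 0 /\ z = f x / f y.
  pose r := repr z; exists (frac r).1, (frac r).2; split; first exact: denom_ratioP.
  apply: (canRL (mulfK _)); first by rewrite tofrac_eq0 denom_ratioP.
  rewrite /f -{1}[z]reprK; unlock FracField.tofrac; rewrite -[LHS]FracField.pi_mul.
  apply/eqP; rewrite FracField.equivf_def /FracField.mulf.
  by rewrite !numden_Ratio ?mulr1 ?oner_eq0 ?denom_ratioP // mulrC.
have [a [u [v [ax ay]]]] := elt x y.
have fD := @tofracD D : {morph f : s t / s + t}.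
have fM := @tofracM D : {morph f : s t / s * t}.
have fX n := @tofracXn D n : {morph f : s / s ^+ n}.
have fy0 : f y != 0 by rewrite tofrac_eq0.
have za : z * f a = f u.
  by rewrite zE mulrAC -tofracM [x * _]mulrC ax tofracM mulfK.
have ze : f (1 - a) = z * f v.
  by rewrite zE mulrAC -tofracM [x * v]mulrC -ay tofracM mulfK.
have clearing n (q : {poly D}) : (size q <= n.+1)%N ->
    exists r, (map_poly f q).[z] * f v ^+ n = f r.
  elim/poly_ind: q n => [n _|q c IHq n].
    by exists 0; rewrite map_poly0 horner0 mul0r [RHS]tofrac0.
  rewrite size_MXaddC rmorphD rmorphM /= map_polyX map_polyC hornerMXaddC.
  case: n => [|n].
    case: (eqVneq q 0) => [-> _|q0]; last by rewrite ltnS leqn0 size_poly_eq0 (negPf q0).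
    by exists c; rewrite map_poly0 horner0 mul0r add0r expr0 mulr1.
  move=> sq; have [|r er] := IHq n; first by case: ifP sq => // /andP[/eqP ->]; rewrite size_poly0.
  exists (r * (1 - a) + c * v ^+ n.+1).
  by rewrite fD !fM fX -er ze exprS; ring.
have [n sp] : exists n, size p = n.+2.
  case sp : (size p) => [|[|n]]; last by exists n.
    by have := monic_neq0 mp; rewrite -size_poly_eq0 sp.
  have p1 : p = 1%:P by rewrite [p]size1_polyC ?sp // -(monicP mp) lead_coefE sp.
  by move: rp; rewrite p1 map_polyC rootC /= tofrac1 oner_eq0.
have [|r er] := clearing n (p - 'X^(n.+1)).
  apply/leq_sizeP => j; rewrite leq_eqVlt coefB coefXn => /predU1P[<-|nj].
    by rewrite eqxx -[n.+1]/(n.+2.-1) -sp -lead_coefE (monicP mp) subrr.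
  by rewrite nth_default ?sp // gtn_eqF // subr0.
have zr : z * f (1 - a) ^+ n = f (- r).
  rewrite ze exprMn mulrA -exprS [RHS]tofracN -/f -er rmorphB /= map_polyXn.
  by rewrite hornerD hornerN hornerXn (rootP rp) sub0r mulNr opprK.
exists (- r + u * \sum_(i < n) (1 - a) ^+ i); rewrite -/(f _) fD fM -zr -za -fX.
have -> : (1 - a) ^+ n = 1 - a * \sum_(i < n) (1 - a) ^+ i.
  have -> : (1 - a) ^+ n = (1 - a) ^+ n - 1 + 1 by rewrite subrK.
  by rewrite subrX1; ring.
by rewrite /f tofracB tofracM tofrac1; ring.
Qed.

(** For a proper ideal [J] above a nonzero prime [P] and [j] in [J] outside [P],
    distributivity makes every element of [P] divisible by [j] inside [P] up to a
    factor from [1 + J], which is impossible for a nonzero element. *)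
Lemma ldist_primes_maximal : ldist D -> nonzero_primes_maximal D.
Proof.
move=> elt P; rewrite /idealr_closed !inE => -[P0 P1 PL] primeP [p0 Pp0 p00] J.
rewrite /idealr_closed !inE => -[J0 J1 JL] PJ.
have {}P1 : ~ P 1 by move: P1 => /negP; rewrite inE.
have {}J1 : ~ J 1 by move: J1 => /negP; rewrite inE.
have {}PL a u v : P u -> P v -> P (a * u + v).
  by move=> Pu Pv; have := PL a u v; rewrite !inE; apply.
have {}JL a u v : J u -> J v -> J (a * u + v).
  by move=> Ju Jv; have := JL a u v; rewrite !inE; apply.
have {}primeP u v : P (u * v) -> P u \/ P v.
  by move=> Puv; have := primeP u v; rewrite !inE => /(_ Puv)/orP[]; rewrite inE; [left|right].
apply/seteqP; split=> // j Jj; apply: contrapT => Pj.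
have PM a u : P u -> P (a * u) by move=> Pu; rewrite -[_ * _]addr0; exact: PL.
have JM a u : J u -> J (a * u) by move=> Ju; rewrite -[_ * _]addr0; exact: JL.
have JD u v : J u -> J v -> J (u + v) by move=> Ju Jv; rewrite -[u]mul1r; exact: JL.
have [] : [set x | P x /\ x <> 0]%classic 0; last by [].
apply: (@division_chain_vanishes (fun s => J (1 - s)) _ j); last by exists p0.
- by rewrite subrr.
- move=> s t Js Jt; rewrite (_ : 1 - s * t = t * (1 - s) + (1 - t)); last by ring.
  exact: JL.
- move=> d Jd; apply: J1; rewrite (_ : 1 = (1 - j * d) + d * j); last by ring.
  by apply: JD => //; exact: JM.
move=> x [Px /eqP x0]; have [a [u [v [aj ax]]]] := elt j x.
have Pa : P a.
  by have [] : P a \/ P j by apply: primeP; rewrite aj; exact: PM.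
have Pv : P v.
  by have [] : P v \/ P j by apply: primeP; rewrite -ax; exact: PM.
exists v, (1 - a); split; last by rewrite ax mulrC.
  split=> // v0; move/eqP: ax; rewrite v0 mul0r mulf_eq0 (negPf x0) orbF.
  by rewrite subr_eq0 => /eqP a1; apply: P1; rewrite a1.
by rewrite opprB addrC subrK; exact: PJ.
Qed.

End NoetherianDomain.

(** * Transfer along surjections and finite products *)

(** A ring morphism read between the converse rings, which reduces statements
    about right modules to those about left modules. *)
Definition conv_morph (A B : nzRingType) (f : A -> B) : A^c -> B^c := f.

HB.instance Definition _ (A B : nzRingType) (f : {rmorphism A -> B}) :=
  GRing.isZmodMorphism.Build A^c B^c (conv_morph f) (rmorphB f).
HB.instance Definition _ (A B : nzRingType) (f : {rmorphism A -> B}) :=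
  GRing.isMonoidMorphism.Build A^c B^c (conv_morph f)
    (rmorph1 f, fun x y => rmorphM f y x).

Section Surjection.
Variables (A B : nzRingType) (f : {rmorphism A -> B}).
Hypothesis surjf : forall b, exists a, f a = b.

Lemma ldist_surj : ldist A -> ldist B.
Proof.
move=> elt x y; have [[x' <-] [y' <-]] := (surjf x, surjf y).
have [a [u [v [ax ay]]]] := elt x' y'; exists (f a), (f u), (f v).
by rewrite -(rmorph1 f) -rmorphB -!rmorphM ax ay.
Qed.

Lemma lideal_image (I : set A) : lideal I -> lideal (f @` I)%classic.
Proof.
move=> [I0 ID IM]; split=> [|_ _ [x Ix <-] [y Iy <-]|b _ [x Ix <-]].
- by exists 0; rewrite ?rmorph0.
- by exists (x + y); rewrite ?rmorphD //; exact: ID.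
- by have [a <-] := surjf b; exists (a * x); rewrite ?rmorphM //; exact: IM.
Qed.

Lemma left_noetherian_surj : left_noetherian_ring A -> left_noetherian_ring B.
Proof.
move=> noethA I idI incI.
have [n||N stab] := noethA (fun n => f @^-1` I n)%classic.
- have /submoduleP[I0 ID IM] := idI n.
  apply/submoduleP; split=> [|x y /= Ix Iy|a x /= Ix]; rewrite /= ?rmorph0 //.
    by rewrite rmorphD; exact: ID.
  by rewrite rmorphM; exact: IM.
- by move=> n x /= /incI.
exists N => n Nn; apply/seteqP; split=> y; have [x <-] := surjf y => Iy.
  by have : (f @^-1` I N)%classic x by rewrite -(stab n Nn).
by have : (f @^-1` I n)%classic x by rewrite (stab n Nn).
Qed.

End Surjection.

Section Product.
Variables (A : nzRingType) (n : nat) (B : 'I_n -> nzRingType)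
  (f : forall i, {rmorphism A -> B i}).
Hypothesis bijf : bijective (fun (a : A) (i : 'I_n) => f i a).

Lemma prod_elem (h : forall i, B i) : exists a, forall i, f i a = h i.
Proof.
by case: bijf => g _ fg; exists (g h) => i; rewrite -[RHS](congr1 (fun k => k i) (fg h)).
Qed.

Lemma prod_ext (a b : A) : (forall i, f i a = f i b) -> a = b.
Proof. by case: bijf => g gf _ ab; apply: (can_inj gf); exact: functional_extensionality_dep. Qed.

Lemma prod_single i (b : B i) : exists a, f i a = b /\ forall j, j <> i -> f j a = 0.
Proof.
pose h j : B j := if pselect (i = j) is left ij
  then eq_rect i (fun k => B k : Type) b j ij else 0.
have [a ea] := prod_elem h; exists a; split=> [|j ji]; rewrite ea /h; case: pselect => // ii.
  by rewrite (Prop_irrelevance ii erefl).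
by case: ji.
Qed.

Lemma prod_choice (P : forall i, B i -> Prop) :
  (forall i, exists b, P i b) -> exists a, forall i, P i (f i a).
Proof.
move=> ex; have [a ea] := prod_elem (fun i => projT1 (cid (ex i))).
by exists a => i; rewrite ea; case: (cid (ex i)).
Qed.

Lemma ldist_prod : (forall i, ldist (B i)) -> ldist A.
Proof.
move=> elt x y.
have [a ha] := prod_choice (fun i => elt i (f i x) (f i y)).
have [u hu] := prod_choice ha.
have [v hv] := prod_choice hu.
exists a, u, v; split; apply: prod_ext => i; have [ax ay] := hv i.
  by rewrite !rmorphM.
by rewrite !rmorphM rmorphB rmorph1.
Qed.

Lemma centrally_essential_prod :
  (forall i, centrally_essential (B i)) -> centrally_essential A.
Proof.
move=> ceB a a0.
have [i ai] : exists i, f i a <> 0.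
  apply: contrapT => /forallNP h; apply: a0; apply: prod_ext => i.
  by rewrite rmorph0; exact: contrapT (h i).
have [c [d [cc cd c0 d0 e]]] := ceB i _ ai.
have [c' [ci cj]] := prod_single c; have [d' [di dj]] := prod_single d.
have central b b' : ring_center b -> f i b' = b ->
    (forall j, j <> i -> f j b' = 0) -> ring_center b'.
  move=> cb bi bj x; apply: prod_ext => j; rewrite !rmorphM.
  have [->|ji] := pselect (j = i); first by rewrite bi; exact: cb.
  by rewrite bj // mul0r mulr0.
exists c', d'; split; [exact: central ci cj|exact: central di dj| | |].
- by move=> c'0; apply: c0; rewrite -ci c'0 rmorph0.
- by move=> d'0; apply: d0; rewrite -di d'0 rmorph0.
- apply: prod_ext => j; rewrite rmorphM.
  have [->|ji] := pselect (j = i); first by rewrite ci di.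
  by rewrite cj // dj // mulr0.
Qed.

(** A left ideal of a finite product is the product of its projections, because
    it is stable under the idempotents of the factors. *)
Lemma prod_lideal (I : set A) x : lideal I ->
  (forall i, (f i @` I)%classic (f i x)) -> I x.
Proof.
move=> [I0 ID IM] Ix.
pose y i := s2val (cid2 (Ix i)).
have Iy i : I (y i) by rewrite /y; case: cid2.
have fy i : f i (y i) = f i x by rewrite /y; case: cid2.
pose e i := projT1 (cid (@prod_single i 1)).
have ei i : f i (e i) = 1 by rewrite /e; case: cid => ? [].
have ej i j : j != i -> f j (e i) = 0.
  by move=> /eqP ji; rewrite /e; case: cid => a [ha hb]; exact: hb.
have -> : x = \sum_i e i * y i.
  apply: prod_ext => j; rewrite rmorph_sum (bigD1 j) //= big1 => [|i ij].
    by rewrite rmorphM ei mul1r addr0 fy.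
  by rewrite rmorphM ej 1?eq_sym // mul0r.
by apply: (big_ind I) => // i _; exact: IM.
Qed.

Lemma left_noetherian_prod :
  (forall i, left_noetherian_ring (B i)) -> left_noetherian_ring A.
Proof.
move=> noethB I /(_ _)/submoduleP idI incI.
have surjf i b : exists a, f i a = b.
  by have [a []] := prod_single b; exists a.
have stabi i := noethB i (fun n => f i @` I n)%classic
  (fun n => proj2 (submoduleP _) (lideal_image (surjf i) (idI n)))
  (fun n => @image_subset _ _ (f i) _ _ (incI n)).
pose N i := projT1 (cid (stabi i)).
exists (\max_i N i)%N => m Nm; apply/seteqP; split.
  move=> x Ix; apply: prod_lideal => // i.
  have := projT2 (cid (stabi i)); rewrite -/(N i) => stab.
  rewrite (stab _ (leq_bigmax i)) -(stab m); last exact: leq_trans (leq_bigmax i) Nm.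
  by exists x.
rewrite -(subnKC Nm); elim: (m - _)%N => [|k IHk]; first by rewrite addn0.
by rewrite addnS; apply: (subset_trans IHk); exact: incI.
Qed.

End Product.

Lemma ring_product_converse (A : nzRingType) (n : nat) (B : 'I_n -> nzRingType) :
  ring_product A B -> ring_product A^c (fun i => (B i)^c).
Proof. by move=> [f bijf]; exists (fun i => conv_morph (f i)). Qed.

(** * The two kinds of factors *)

Lemma uniserial_ldist (A : nzRingType) : left_uniserial_ring A -> ldist A.
Proof.
move=> uni x y; case: (left_comparable uni x y) => -[a e].
  by exists 1, a, 0; rewrite mul1r subrr !mul0r.
by exists 0, 0, a; rewrite subr0 mul1r !mul0r.
Qed.

Lemma factor_properties (B : nzRingType) :
  ([/\ uniserial_ring B, artinian_ring B & centrally_essential B]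
   \/ commutative_dedekind_domain B) ->
  [/\ distributive_ring B, noetherian_ring B & centrally_essential B].
Proof.
case=> [[uni art ce]|[D [[noethR noethL] intD primeD] [f bijf]]].
  split=> //; last exact: uniserial_artinian_noetherian.
  by case: uni => uR uL; split; apply/left_distributiveP; exact: uniserial_ldist.
have surjf b : exists a, f a = b by case: bijf => g _ fg; exists (g b).
have elt := dedekind_ldist noethL intD primeD.
have commB x y : x * y = y * x :> B.
  by have [[a <-] [b <-]] := (surjf x, surjf y); rewrite -!rmorphM mulrC.
split.
- split; apply/left_distributiveP; last exact: (ldist_surj surjf).
  move=> x y; have [a [u [v [ax ay]]]] := ldist_surj surjf elt x y.
  exists a, u, v; split; [change (@GRing.mul B x a = @GRing.mul B y u)|
    change (@GRing.mul B y (1 - a) = @GRing.mul B x v)].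
    by rewrite commB ax commB.
  by rewrite commB ay commB.
- split; last exact: (left_noetherian_surj surjf).
  exact: (@left_noetherian_surj D^c B^c (conv_morph f) surjf noethR).
- move=> a a0; exists 1, a; rewrite mulr1; split=> //.
  exact/eqP/oner_neq0.
Qed.

Lemma product_properties (A : nzRingType) (n : nat) (B : 'I_n -> nzRingType) :
  ring_product A B ->
  (forall i, [/\ distributive_ring (B i), noetherian_ring (B i)
                & centrally_essential (B i)]) ->
  [/\ distributive_ring A, noetherian_ring A & centrally_essential A].
Proof.
move=> prodA propB.
have [g bijg] := ring_product_converse prodA; have [f bijf] := prodA.
split; last by apply: (centrally_essential_prod bijf) => i; case: (propB i).
- split; apply/left_distributiveP.
    by apply: (ldist_prod bijg) => i; apply/left_distributiveP; case: (propB i) => -[].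
  by apply: (ldist_prod bijf) => i; apply/left_distributiveP; case: (propB i) => -[].
- split; first by apply: (left_noetherian_prod bijg) => i; case: (propB i) => _ [].
  by apply: (left_noetherian_prod bijf) => i; case: (propB i) => _ [].
Qed.

(** * Central idempotents *)

Section Corner.
Variables (A : nzRingType) (e : A).

Definition central_idempotent : Prop := e * e = e /\ ring_center e.

Hypotheses (he : central_idempotent) (e0 : e != 0).

(** The hypotheses are arguments of the type, so that the ring structure, which
    depends on them, can be attached to it. *)
Definition corner of central_idempotent & e != 0 : Type := {x : A | e * x == x}.

Local Notation eA := (corner he e0).

HB.instance Definition _ := Choice.copy eA {x : A | e * x == x}.

Let idem : e * e = e. Proof. by case: he. Qed.
Let central x : e * x = x * e. Proof. by case: he => _; exact. Qed.

Lemma corner_mem (x : A) : e * (e * x) == e * x.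
Proof. by rewrite mulrA idem. Qed.

Definition to_corner (x : A) : eA := exist _ (e * x) (corner_mem x).

Let cval (x : eA) : A := sval x.

Lemma cval_to_corner x : cval (to_corner x) = e * x. Proof. by []. Qed.

Lemma cvalP (x : eA) : e * cval x = cval x. Proof. exact/eqP/(svalP x). Qed.

Lemma cval_inj : injective cval. Proof. exact: val_inj. Qed.

Definition corner_add (x y : eA) := to_corner (cval x + cval y).
Definition corner_opp (x : eA) := to_corner (- cval x).
Definition corner_mul (x y : eA) := to_corner (cval x * cval y).

Lemma cvalD x y : cval (corner_add x y) = cval x + cval y.
Proof. by rewrite cval_to_corner mulrDr !cvalP. Qed.
Lemma cvalN x : cval (corner_opp x) = - cval x.
Proof. by rewrite cval_to_corner mulrN cvalP. Qed.
Lemma cvalM x y : cval (corner_mul x y) = cval x * cval y.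
Proof. by rewrite cval_to_corner mulrA cvalP. Qed.
Lemma cval0 : cval (to_corner 0) = 0. Proof. by rewrite cval_to_corner mulr0. Qed.
Lemma cval1 : cval (to_corner 1) = e. Proof. by rewrite cval_to_corner mulr1. Qed.

Fact corner_addA : associative corner_add.
Proof. by move=> x y z; apply: cval_inj; rewrite !cvalD addrA. Qed.
Fact corner_addC : commutative corner_add.
Proof. by move=> x y; apply: cval_inj; rewrite !cvalD addrC. Qed.
Fact corner_add0 : left_id (to_corner 0) corner_add.
Proof. by move=> x; apply: cval_inj; rewrite cvalD cval0 add0r. Qed.
Fact corner_addN : left_inverse (to_corner 0) corner_opp corner_add.
Proof. by move=> x; apply: cval_inj; rewrite cvalD cvalN cval0 addNr. Qed.

HB.instance Definition _ :=
  GRing.isZmodule.Build eA corner_addA corner_addC corner_add0 corner_addN.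

Fact corner_mulA : associative corner_mul.
Proof. by move=> x y z; apply: cval_inj; rewrite !cvalM mulrA. Qed.
Fact corner_mul1 : left_id (to_corner 1) corner_mul.
Proof. by move=> x; apply: cval_inj; rewrite cvalM cval1 cvalP. Qed.
Fact corner_1mul : right_id (to_corner 1) corner_mul.
Proof. by move=> x; apply: cval_inj; rewrite cvalM cval1 -central cvalP. Qed.
Fact corner_mulDl : left_distributive corner_mul corner_add.
Proof. by move=> x y z; apply: cval_inj; rewrite !(cvalM, cvalD) mulrDl. Qed.
Fact corner_mulDr : right_distributive corner_mul corner_add.
Proof. by move=> x y z; apply: cval_inj; rewrite !(cvalM, cvalD) mulrDr. Qed.
Fact corner_neq0 : to_corner 1 != 0.
Proof.
by apply: contra e0 => /eqP /(congr1 cval); rewrite cval1 cval0 => ->.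
Qed.

HB.instance Definition _ := GRing.Zmodule_isNzRing.Build eA
  corner_mulA corner_mul1 corner_1mul corner_mulDl corner_mulDr corner_neq0.

Fact to_corner_additive : zmod_morphism to_corner.
Proof.
by move=> x y; apply: cval_inj; rewrite cvalD cvalN !cval_to_corner mulrBr.
Qed.
Fact to_corner_multiplicative : monoid_morphism to_corner.
Proof.
split=> // x y; apply: cval_inj; rewrite cvalM !cval_to_corner.
by rewrite [RHS]mulrA -(central (e * x)) [e * (e * x)]mulrA idem mulrA.
Qed.

HB.instance Definition _ :=
  GRing.isZmodMorphism.Build A eA to_corner to_corner_additive.
HB.instance Definition _ :=
  GRing.isMonoidMorphism.Build A eA to_corner to_corner_multiplicative.

(** The corner [eA], seen as the quotient of [A] by the annihilator of [e]. *)
Lemma corner_quotient : exists (B : nzRingType) (f : {rmorphism A -> B}),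
  (forall b, exists a, f a = b) /\ (forall x, f x = 0 <-> e * x = 0).
Proof.
exists eA, to_corner; split=> [b|x].
  by exists (cval b); apply: cval_inj; rewrite cval_to_corner cvalP.
split=> [/(congr1 cval)|ex0]; first by rewrite cval0.
by apply: cval_inj; rewrite cval0.
Qed.

End Corner.

Section Idempotents.
Variable A : nzRingType.

(** A nonzero central multiple [d] of [e x (1 - e)] would satisfy
    [d = e d = d e = 0]. *)
Lemma centrally_essential_idempotent (e : A) :
  centrally_essential A -> e * e = e -> ring_center e.
Proof.
move=> ce ee x.
have half (u v : A) : v * u = 0 -> u * u = u -> v * v = v -> u * x * v = 0.
  move=> vu uu vv; apply: contrapT => /ce[c [d [cc cd c0 d0 exc]]]; apply: d0.
  have ud : u * d = d by rewrite -exc !mulrA uu.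
  by rewrite -ud -(cd u) -exc -mulrA (cc u) -!mulrA [v * _]mulrA vu mul0r !mulr0.
have e1 : (1 - e) * (1 - e) = 1 - e.
  by rewrite mulrBl mul1r mulrBr mulr1 ee subrr subr0.
have l : e * x * (1 - e) = 0 by apply: half => //; rewrite mulrBl mul1r ee subrr.
have r : (1 - e) * x * e = 0 by apply: half => //; rewrite mulrBr mulr1 ee subrr.
move/eqP: l; rewrite mulrBr mulr1 subr_eq0 => /eqP l.
move/eqP: r; rewrite !mulrBl mul1r subr_eq0 => /eqP r.
by rewrite /GRing.comm l r.
Qed.

Definition primitive (e : A) : Prop :=
  [/\ e * e = e, e <> 0 & forall g, g * g = g -> g * e = g -> g = 0 \/ g = e].

Hypotheses (ce : centrally_essential A) (noethA : left_noetherian_ring A).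

Let cidem (e : A) (ee : e * e = e) x : e * x = x * e :=
  centrally_essential_idempotent ce ee x.

(** A primitive idempotent below [1 - e]: its annihilator is as large as
    possible. *)
Lemma primitive_exists (e : A) : e * e = e -> e <> 1 ->
  exists2 f, primitive f & f * e = 0.
Proof.
move=> ee e1.
have [||f [ff f0 fe] maxf] := @noetherian_maximal A A
    (fun f => [/\ f * f = f, f <> 0 & f * e = 0]) (fun f => [set x | x * f = 0]%classic) noethA.
- by move=> f _; exact: lideal_ann.
- exists (1 - e); split; last by rewrite mulrBl mul1r ee subrr.
    by rewrite mulrBl mul1r mulrBr mulr1 ee subrr subr0.
  by move/eqP; rewrite subr_eq0 => /eqP /esym.
exists f => //; split=> // g gg gf; have [g0|g0] := pselect (g = 0); [by left|right].
have /= := maxf g _ _ (1 - g); rewrite !mulrBl !mul1r gf gg subrr => maxg.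
apply/esym/eqP; rewrite -subr_eq0; apply/eqP/maxg => // [|x xf].
  by split=> //; rewrite -gf -mulrA fe mulr0.
by rewrite /= -gf (cidem gg) mulrA xf mul0r.
Qed.

(** A sum [e] of orthogonal primitive idempotents with [Ae] as large as possible
    is [1], because otherwise a primitive idempotent below [1 - e] could be
    added. *)
Lemma idempotent_decomposition : exists s : seq A,
  [/\ forall f, f \in s -> primitive f,
      pairwise (fun f g => f * g == 0) s & \sum_(f <- s) f = 1].
Proof.
have [||e [ee [s [prims orths sume]]] maxe] := @noetherian_maximal A A
    (fun e => e * e = e /\ exists s : seq A, [/\ forall f, f \in s -> primitive f,
      pairwise (fun f g => f * g == 0) s & \sum_(f <- s) f = e])
    (fun e => [set x | exists a, x = a * e]%classic) noethA.
- by move=> e _; exact: lideal_principal.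
- by exists 0; split; [rewrite mul0r|exists [::]; rewrite big_nil].
have [<-|e1] := pselect (e = 1); first by exists s.
have [f [ff f0 primf] fe] := primitive_exists ee e1.
have ef : e * f = 0 by rewrite (cidem ee).
have ge g : g \in s -> e * g = g.
  move=> gs; have [gg _ _] := prims g gs.
  rewrite -sume; elim: s gs orths prims {sume} => // h s IHs.
  rewrite big_cons mulrDl inE pairwise_cons => /orP[/eqP->|gs] /andP[/allP hs orths] prims.
    have [hh _ _] := prims h (mem_head _ _); rewrite hh mulr_suml big1_seq ?addr0 // => k /= ks.
    by rewrite -(cidem hh); exact/eqP/hs.
  rewrite (eqP (hs g gs)) add0r IHs // => k ks.
  by apply: prims; rewrite inE ks orbT.
have [|||a fa] := maxe (e + f) _ _ (e + f).
- split; first by rewrite mulrDl !mulrDr ee ef fe ff addr0 add0r.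
  exists (f :: s); split; last by rewrite big_cons sume addrC.
    by move=> g; rewrite inE => /orP[/eqP->|/prims].
  rewrite pairwise_cons orths andbT; apply/allP => g gs.
  by rewrite -(ge g gs) mulrA fe mul0r.
- by move=> _ [a ->]; exists (a * e); rewrite mulrDr -!mulrA ee ef mulr0 addr0.
- by exists 1; rewrite mul1r.
case: f0; have : (e + f) * f = f by rewrite mulrDl ef add0r ff.
by rewrite fa -mulrA ef mulr0.
Qed.

End Idempotents.

(** * Indecomposable rings: central elements *)

Lemma right_distributiveP (A : nzRingType) : right_distributive_ring A ->
  forall x y : A, exists a u v, x * a = y * u /\ y * (1 - a) = x * v.
Proof. by move/(@left_distributiveP A^c). Qed.

Lemma mul_1B_1B (A : nzRingType) (a b : A) :
  (1 - a) * (1 - b) = 1 - (a + b - a * b).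
Proof.
rewrite mulrBl mul1r mulrBr mulr1 !opprB !addrA [1 - b + _]addrAC.
by rewrite -[LHS]addrA -opprD [b + a]addrC.
Qed.

Lemma ring_centerM (A : nzRingType) (c d : A) :
  ring_center c -> ring_center d -> ring_center (c * d).
Proof. by move=> cc cd x; rewrite /GRing.comm -mulrA (cd x) mulrA (cc x) mulrA. Qed.

Lemma ring_centerX (A : nzRingType) (c : A) n : ring_center c -> ring_center (c ^+ n).
Proof.
move=> cc; elim: n => [|n IHn]; first by move=> x; rewrite /GRing.comm mul1r mulr1.
by rewrite exprS; exact: ring_centerM.
Qed.

Lemma ring_center_inv (A : nzRingType) (b c : A) :
  ring_center c -> b * c = 1 -> c * b = 1 -> ring_center b.
Proof.
move=> cc bc cb y; rewrite /GRing.comm -[y * b]mul1r -bc -!mulrA [c * _]mulrA (cc y).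
by rewrite -[y * c * b]mulrA cb mulr1.
Qed.

Definition regular (A : nzRingType) (c : A) : Prop := forall x, c * x = 0 -> x = 0.

Section Indecomposable.
Variable A : nzRingType.
Hypotheses (noethA : left_noetherian_ring A) (ce : centrally_essential A)
  (elt : forall x y : A, exists a u v, x * a = y * u /\ y * (1 - a) = x * v)
  (indec : forall e : A, e * e = e -> e = 0 \/ e = 1).

(** In place of a finite set of generators of [I], one takes [a] for which the
    set of all [y] with [y (1 - a)] in [N] is as large as possible. *)
Lemma uniform_coefficient (I N : set A) : lideal I -> ideal N ->
  (forall y, I y -> exists a, I a /\ N (y * (1 - a))) ->
  exists a, I a /\ forall y, I y -> N (y * (1 - a)).
Proof.
move=> idI [idN Nr] ex; have [I0 ID IM] := idI; have [N0 ND NM] := idN.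
have [||a Ia maxa] := @noetherian_maximal A A I
    (fun a => [set y | N (y * (1 - a))]%classic) noethA.
- move=> a _; split=> [|x y /= Nx Ny|b x /= Nx]; first by rewrite /= mul0r.
    by rewrite mulrDl; exact: ND.
  by rewrite -mulrA; exact: NM.
- by exists 0.
exists a; split=> // y Iy.
have [|b [Ib Nb]] := ex (y * (1 - a)).
  by rewrite mulrBr mulr1; apply: (lidealB idI) => //; exact: IM.
apply: (maxa (a + b - a * b)) => [|x /= Nx|] /=; last by rewrite -mul_1B_1B mulrA.
- by apply: (lidealB idI); [exact: ID|exact: IM].
- by rewrite -mul_1B_1B mulrA; exact: Nr.
Qed.

(** For central [c], some power [d] satisfies [dA] meets [ann d] trivially;
    distributivity then makes [ann d] a direct summand generated by a central
    idempotent. *)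
Lemma central_regular_or_nilpotent (c : A) : ring_center c ->
  regular c \/ exists n, c ^+ n = 0.
Proof.
move=> cc.
have [||n _ maxn] := @noetherian_maximal A nat (fun=> True)
    (fun n => [set x | x * c ^+ n = 0]%classic) noethA.
- by move=> n _; exact: lideal_ann.
- by exists 0%N.
have cX m x : c ^+ m * x = x * c ^+ m := ring_centerX m cc x.
have stab m x : x * c ^+ (n + m) = 0 -> x * c ^+ n = 0.
  move=> h; apply: (maxn (n + m)%N) => // y /= yn.
  by rewrite exprD mulrA yn mul0r.
set d := c ^+ n in stab *.
have dx0 x : d * (d * x) = 0 -> d * x = 0.
  rewrite mulrA -exprD cX => /stab; by rewrite /d cX.
have [a [da Ia]] : exists a, d * a = 0 /\ forall y, d * y = 0 -> y * (1 - a) = 0.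
  apply: (uniform_coefficient (I := [set y | d * y = 0]%classic) (N := [set 0]%classic)).
  - split=> [|x y /= dx dy|a x /= dx]; first by rewrite /= mulr0.
      by rewrite mulrDr dx dy addr0.
    by rewrite mulrA cX -mulrA dx mulr0.
  - split=> [|x a /= ->]; last exact: mul0r.
    by split=> [|x y /= -> ->|a x /= ->]; rewrite ?addr0 ?mulr0.
  - move=> y /= dy; have [a [u [v [da ya]]]] := elt d y; exists a; split.
      by apply: dx0; rewrite da mulrA dy mul0r.
    by rewrite ya; apply: dx0; rewrite -ya mulrA dy mul0r.
have [|a0|a1] := indec (e := a).
- by have := Ia a da; rewrite mulrBr mulr1 => /eqP; rewrite subr_eq0 => /eqP.
- left=> x cx; have : x * c ^+ (n + 1) = 0 by rewrite addn1 exprS mulrA -(cc x) cx mul0r.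
  move/stab; rewrite -/d => xd; have := Ia x; rewrite a0 subr0 mulr1; apply.
  by rewrite cX.
- by right; exists n; rewrite -/d -[d]mulr1 -a1.
Qed.

(** Each nonzero [x] has a central multiple [x c = d] with [c] and [d] regular;
    commutators and zero divisors can be tested after multiplying by [c]. *)
Lemma regular_center_domain :
  (forall c : A, ring_center c -> c <> 0 -> regular c) ->
  (forall x y : A, x * y = y * x) /\
  (forall x y : A, x * y = 0 -> x = 0 \/ y = 0).
Proof.
move=> reg; split=> x y.
  have [->|x0] := pselect (x = 0); first by rewrite mul0r mulr0.
  have [c [d [cc cd c0 d0 e]]] := ce x0.
  apply/eqP; rewrite -subr_eq0; apply/eqP/(reg c cc c0).
  by rewrite mulrBr mulrA (cc x) e (cd y) -e (cc (y * x)) mulrA subrr.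
move=> xy; have [x0|x0] := pselect (x = 0); [by left|right].
have [c [d [cc cd c0 d0 e]]] := ce x0.
by apply: (reg d cd d0); rewrite -e -mulrA (cc y) mulrA xy mul0r.
Qed.

(** * Indecomposable rings with a nilpotent central element *)

Section NilpotentCenter.
Variable t0 : A.
Hypotheses (ct0 : ring_center t0) (t0_neq0 : t0 <> 0) (nt0 : exists n, t0 ^+ n = 0).

Definition central_nilpotents : set A :=
  [set u | ring_center u /\ exists n, u ^+ n = 0]%classic.

Local Notation m := central_nilpotents.

(** [s (1 - a) = t v] makes [1 - a] nilpotent, hence [a] invertible, and
    [t a] lies in [s A]. *)
Lemma central_nilpotent_divisible (s t : A) : ring_center s -> regular s -> m t ->
  exists2 t', m t' & t = s * t'.
Proof.
move=> cs rs [ct [k tk]]; have [a [u [v [ta sa]]]] := elt t s.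
have regX n : regular (s ^+ n).
  elim: n => [|n IHn] x; first by rewrite expr0 mul1r.
  by rewrite exprS -mulrA => /rs /IHn.
have expc (c x : A) n : ring_center c -> (c * x) ^+ n = c ^+ n * x ^+ n.
  by move=> cc; apply: exprMn_comm; exact: cc.
have n1a : (1 - a) ^+ k = 0.
  by apply: (regX k); rewrite -expc // sa expc // tk mul0r.
have [b [ba ab]] := exp0_unit n1a; rewrite opprB addrC subrK in ba ab.
have tE : t = s * (u * b) by rewrite mulrA -ta -mulrA ab mulr1.
exists (u * b) => //; split.
  move=> x; apply/eqP; rewrite -subr_eq0; apply/eqP/rs.
  by rewrite mulrBr [s * (u * b * x)]mulrA -tE [s * (x * _)]mulrA (cs x) -mulrA -tE (ct x) subrr.
exists k; apply: (regX k); by rewrite -expc // -tE.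
Qed.

(** Dividing [t] by [s] repeatedly gives an ascending chain of left ideals. Where
    it stops, the next quotient [t''] satisfies [t'' = r s t''], and [t] is a
    multiple of [t'']. *)
Lemma central_nilpotent_killed (s t : A) : ring_center s -> regular s -> m t ->
  exists r, t * (1 - r * s) = 0.
Proof.
move=> cs rs mt.
have [||t' [mt' [k tE]] maxt] := @noetherian_maximal A A
    (fun t' => m t' /\ exists k, t = s ^+ k * t')
    (fun t' => [set w | exists a, w = a * t']%classic) noethA.
- by move=> t' _; exact: lideal_principal.
- by exists t; split=> //; exists 0%N; rewrite expr0 mul1r.
have [t'' mt'' t'E] := central_nilpotent_divisible cs rs mt'.
have [|||r e] := maxt t'' _ _ t''.
- by split=> //; exists k.+1; rewrite exprSr -mulrA -t'E.
- by move=> _ [a ->]; exists (a * s); rewrite -mulrA -t'E.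
- by exists 1; rewrite mul1r.
exists r; have [ct _] := mt; rewrite (ct (1 - r * s)) tE t'E [s ^+ k * _]mulrA -exprSr.
have cX : s ^+ k.+1 * (1 - r * s) = (1 - r * s) * s ^+ k.+1 by exact: ring_centerX.
rewrite mulrA -cX -mulrA mulrBl mul1r.
by rewrite -mulrA -t'E -e subrr mulr0.
Qed.

(** With [p = 1 - r s] killing every central nilpotent, a nonzero central
    multiple [p c = d] forces [d] to be nilpotent and [c] regular, so [p] itself
    is nilpotent and [r s = 1 - p] invertible. *)
Lemma central_regular_unit (s : A) : ring_center s -> regular s -> isunit s.
Proof.
move=> cs rs.
have [r hr] : exists r, forall t, m t -> t * (1 - r * s) = 0.
  have [||r _ maxr] := @noetherian_maximal A A (fun=> True)
      (fun r => [set x | x * (1 - r * s) = 0]%classic) noethA.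
  - by move=> r _; exact: lideal_ann.
  - by exists 0.
  exists r => t mt; have [q qt] := central_nilpotent_killed cs rs mt.
  have E : 1 - (r + q - r * s * q) * s = (1 - r * s) * (1 - q * s).
    by rewrite mul_1B_1B mulrBl mulrDl !mulrA.
  apply: (maxr (r + q - r * s * q)) => // [x /= xr|] /=; rewrite E mulrA ?xr ?mul0r //.
  by case: (mt) => ct _; rewrite (ct (1 - r * s)) -mulrA qt mulr0.
set p := 1 - r * s in hr.
suff [n pn] : exists n, p ^+ n = 0.
  have [w [wrs _]] := exp0_unit pn; rewrite opprB addrC subrK in wrs.
  by exists (w * r); rewrite (cs (w * r)) -mulrA wrs.
have [p0|p0] := pselect (p = 0); first by exists 1%N; rewrite p0.
have [c [d [cc cd c0 d0 e]]] := ce p0.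
have mt0 : m t0 by [].
have md : m d.
  split=> //; have [rd|//] := central_regular_or_nilpotent cd.
  by case: t0_neq0; apply: rd; rewrite -e -mulrA (cc t0) mulrA -(ct0 p) hr // mul0r.
have rc : regular c.
  have [//|nc] := central_regular_or_nilpotent cc.
  by case: d0; rewrite -e -(cc p) hr.
have [d' [_ [n d'n]] dE] := central_nilpotent_divisible cc rc md.
exists n; suff -> : p = d' by [].
by apply/eqP; rewrite -subr_eq0; apply/eqP/rc; rewrite mulrBr -dE (cc p) e subrr.
Qed.

Lemma center_local (c : A) : ring_center c -> m c \/ isunit c.
Proof.
move=> cc; have [rc|nc] := central_regular_or_nilpotent cc; last by left.
by right; exact: central_regular_unit.
Qed.

(** The elements of [A] killed by the maximal ideal of the center. Being central,
    they form the socle of that local ring. *)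
Definition central_socle : set A := [set x | forall u, m u -> x * u = 0]%classic.

(** The factor [c] of a nonzero central multiple [x c] cannot be nilpotent, so it
    is invertible in the center. *)
Lemma central_socle_center x : central_socle x -> ring_center x.
Proof.
move=> Sx; have [->|x0] := pselect (x = 0); first by move=> y; rewrite /GRing.comm mul0r mulr0.
have [c [d [cc cd c0 d0 e]]] := ce x0.
have [mc|[b [bc cb]]] := center_local cc; first by case: d0; rewrite -e Sx.
have cB := ring_center_inv cc bc cb.
by rewrite -[x]mulr1 -cb mulrA e; exact: ring_centerM.
Qed.

Lemma central_socle_mull a x : central_socle x -> central_socle (a * x).
Proof. by move=> Sx u mu; rewrite -mulrA Sx // mulr0. Qed.

Definition socle_ann : set A := [set x | forall s, central_socle s -> x * s = 0]%classic.

Local Notation Q := socle_ann.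

Lemma socle_ann_ideal : ideal Q.
Proof.
split; [split=> [s _|x y Qx Qy s Ss|a x Qx s Ss]|move=> x a Qx s Ss].
- exact: mul0r.
- by rewrite mulrDl Qx // Qy // addr0.
- by rewrite -mulrA Qx // mulr0.
- by rewrite -mulrA Qx //; exact: central_socle_mull.
Qed.

Lemma socle_ann_comm x y : Q (x * y - y * x).
Proof.
move=> s Ss; have cs := central_socle_center Ss.
have cxs := central_socle_center (central_socle_mull x Ss).
by rewrite mulrBl -[x * y * s]mulrA -(cs y) mulrA (cxs y) mulrA subrr.
Qed.

(** Otherwise the chain of annihilators of the powers of [Q] stops at a proper
    ideal [R]. Some central [c] outside [R] satisfies [c u] in [R] for all
    nilpotent central [u]; then [Q ^ n c] lies in the socle, which [Q] kills. *)
Lemma socle_ann_nilp : nilpotent_set Q.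
Proof.
have idQ := socle_ann_ideal.
pose R n : set A := [set x | forall y, products Q n y -> y * x = 0]%classic.
have idR n : lideal (R n).
  split=> [y _|x z Rx Rz y hy|a x Rx y hy]; first exact: mulr0.
    by rewrite mulrDr Rx // Rz // addr0.
  by rewrite mulrA Rx //; exact: products_mulr.
have RS n x : R n.+1 x <-> forall q, Q q -> R n (q * x).
  split=> [Rx q Qq y hy|Rx _ [y [q [hy Qq ->]]]]; last by rewrite -mulrA; exact: Rx.
  by rewrite mulrA; apply: Rx; exists y, q.
have [|n _ maxn] := @noetherian_maximal A nat (fun=> True) R noethA (fun n _ => idR n).
  by exists 0%N.
have stab x : R n.+1 x -> R n x.
  apply: maxn => // {}x Rx; apply/RS => q Qq; by case: (idR n) => _ _; exact.
exists n; apply: contrapT => nonil.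
have R1 : ~ R n 1 by move=> R1; apply: nonil => y /R1; rewrite mulr1.
have [||c [cc Rc] maxc] := @noetherian_maximal A A
    (fun c => ring_center c /\ ~ R n c) (fun c => [set x | R n (x * c)]%classic) noethA.
- move=> c _; have [R0 RD RM] := idR n; split=> [|x y /= Rx Ry|a x /= Rx].
  + by rewrite /= mul0r.
  + by rewrite mulrDl; exact: RD.
  + by rewrite -mulrA; exact: RM.
- by exists 1; split=> // x; rewrite /GRing.comm mul1r mulr1.
have cm u : m u -> R n (c * u).
  move=> [cu [k uk]]; apply: contrapT => Rcu; apply: Rc.
  have sub := maxc (c * u) (conj (ring_centerM cc cu) Rcu).
  have {}sub x : R n (x * (c * u)) -> R n (x * c).
    apply: sub => y /= Ry; rewrite (cc u) mulrA -(cu y) -mulrA.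
    by case: (idR n) => _ _; exact.
  have : R n (u ^+ k * c) by rewrite uk mul0r; case: (idR n).
  elim: k {uk} => [|k IHk]; first by rewrite expr0 mul1r.
  by rewrite exprSr -mulrA -(cc u) => /sub.
apply: Rc; apply: stab; apply/RS => q Qq.
have soc k x : (forall u, m u -> R k (x * u)) -> forall q, Q q -> R k (q * x).
  elim: k x => [|k IHk] x xm {}q {}Qq.
    by move=> y _; rewrite Qq ?mulr0 // => u mu; rewrite -[_ * u]mul1r; exact: xm.
  apply/RS => q' Qq'; apply: IHk => // u mu.
  by rewrite -mulrA; exact: (proj1 (RS _ _) (xm u mu)) Qq.
exact: soc.
Qed.

(** An ideal is maximal among the nilpotent ideals containing [Q] only if it is
    semiprime: modulo commutators, which lie in [Q], the square of [N + A x] is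
    contained in [N + A x x]. *)
Lemma nilradical_exists : exists N : set A, [/\ ideal N, nilpotent_set N,
  forall x y, N (x * y - y * x) & forall x, N (x * x) -> N x].
Proof.
have [||N [idN nilN QN] maxN] := @noetherian_maximal A (set A)
    (fun N => [/\ ideal N, nilpotent_set N & (Q `<=` N)%classic]) id noethA.
- by move=> N [[]].
- by exists Q; split=> //; [exact: socle_ann_ideal|exact: socle_ann_nilp].
have [[N0 ND NM] Nr] := idN; have NC x y := QN _ (socle_ann_comm x y).
exists N; split=> // x Nxx.
pose N' : set A := [set y | exists a, N (y - a * x)]%classic.
have idN' : ideal N'.
  split; [split=> [|y z [a Na] [b Nb]|b y [a Na]]|move=> y b [a Na]].
  - by exists 0; rewrite mul0r subr0.
  - by exists (a + b); rewrite mulrDl opprD addrACA; exact: ND.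
  - by exists (b * a); rewrite -mulrA -mulrBr; exact: NM.
  - exists (a * b); apply: (lideal_sub idN.1 (y := a * (x * b - b * x))); last exact: NM.
    by rewrite mulrBr opprB !mulrA subrKA -mulrBl; exact: Nr.
have N'N' y z : N' y -> N' z -> N (y * z).
  move=> [a Na] [b Nb].
  apply: (lideal_sub idN.1 (y := a * x * z)); first by rewrite -mulrBl; exact: Nr.
  apply: (lideal_sub idN.1 (y := a * x * (b * x))); first by rewrite -mulrBr; exact: NM.
  apply: (lideal_sub idN.1 (y := a * (b * x * x))).
    by rewrite -mulrA -mulrBr mulrA -mulrBl; apply/NM/Nr.
  by rewrite -mulrA; exact/NM/NM.
have nilN' : nilpotent_set N'.
  case: nilN => n hn; exists n.*2 => y hy; apply: hn.
  elim: n y hy => [|n IHn] //= _ [_ [j [[y [i [hy N'i ->]] N'j ->]]]].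
  by exists y, (i * j); split; [exact: IHn|exact: N'N'|rewrite mulrA].
have : (N' `<=` N)%classic.
  by apply: maxN => [|y Ny]; [split=> // y /QN Ny|]; exists 0; rewrite mul0r subr0.
by apply; exists 1; rewrite mul1r subrr.
Qed.

End NilpotentCenter.

(** * Indecomposable rings: the nilradical *)

(** The element [1 - (1 - a ^ k) ^ k] is a multiple of [a ^ k] and its complement
    is a multiple of [(1 - a) ^ k], so it is an idempotent, hence [0] or [1]. *)
Lemma lift_idempotent (a : A) k : (a * (1 - a)) ^+ k = 0 ->
  a ^+ k = 0 \/ (1 - a) ^+ k = 0.
Proof.
have ca : GRing.comm (1 - a) a.
  by apply/commr_sym/commrB; [exact: commr1|exact: commr_refl].
rewrite -ca exprMn_comm // => ak.
have [rW lW] := geometric_sum a k; set W := \sum_(i < k) a ^+ i in rW lW.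
have [rV _] := geometric_sum (1 - a ^+ k) k.
set V := \sum_(i < k) _ in rV; rewrite opprB addrC subrK in rV.
have WE : (1 - a ^+ k) ^+ k = W ^+ k * (1 - a) ^+ k.
  by rewrite -lW exprMn_comm // /GRing.comm lW rW.
have idem : (1 - a ^+ k * V) * (a ^+ k * V) = 0.
  by rewrite {1}rV opprB addrC subrK WE -mulrA [_ * (a ^+ k * V)]mulrA ak mul0r mulr0.
have [|e0|e1] := indec (e := a ^+ k * V).
- by move/eqP: idem; rewrite mulrBl mul1r subr_eq0 => /eqP /esym.
- left; move/eqP: rV; rewrite e0 eq_sym subr_eq0 WE => /eqP e.
  by rewrite -[a ^+ k]mul1r e -mulrA ak mulr0.
- right; have e : (1 - a) ^+ k * (a ^+ k * V) = (1 - a) ^+ k by rewrite e1 mulr1.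
  by rewrite -e mulrA ak mul0r.
Qed.

Section Nilradical.
Variable N : set A.
Hypotheses (idN : ideal N) (nilN : nilpotent_set N)
  (commN : forall x y, N (x * y - y * x)) (semiN : forall x, N (x * x) -> N x)
  (N_neq0 : exists2 x, N x & x <> 0).

Let N0 : N 0. Proof. by case: idN => -[]. Qed.
Let ND x y : N x -> N y -> N (x + y). Proof. by case: idN => -[_ h _] _; exact: h. Qed.
Let NM a x : N x -> N (a * x). Proof. by case: idN => -[_ _ h] _; exact: h. Qed.
Let Nr x a : N x -> N (x * a). Proof. by case: idN => _; exact. Qed.
Let Nsub x y : N (x - y) -> N y -> N x. Proof. exact: lideal_sub idN.1. Qed.

Lemma nilradical_1 : ~ N 1.
Proof.
have [n hn] := nilp_exp nilN.
by move=> /hn /eqP; rewrite expr1n oner_eq0.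
Qed.

Lemma nilradical_unit x : N x -> isunit (1 - x).
Proof. by have [n hn] := nilp_exp nilN; move=> /hn; exact: exp0_unit. Qed.

(** Modulo [N], the ideal of all [y] with [f y] in [N] is generated by an
    idempotent [a], by distributivity for the pairs [f], [y]. As idempotents lift
    and there are only trivial ones, [a] or [1 - a] is nilpotent. *)
Lemma nilradical_prime (f y : A) : N (f * y) -> N f \/ N y.
Proof.
move=> Nfy.
have sq w : N (f * (f * w)) -> N (f * w).
  move=> Nffw; apply: semiN; apply: (Nsub (y := f * (f * w) * w)); last exact: Nr.
  rewrite -!mulrA -mulrBr; apply: NM; rewrite !mulrA -!mulrBl; exact: Nr.
have [||a [/= Nfa Ia]] :=
  uniform_coefficient (I := [set y | N (f * y)]%classic) (N := N) _ idN.
- split=> [|u v /= Nu Nv|b u /= Nu]; first by rewrite /= mulr0.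
    by rewrite mulrDr; exact: ND.
  apply: (Nsub (y := b * (f * u))); last exact: NM.
  by rewrite !mulrA -mulrBl; exact: Nr.
- move=> z /= Nfz; have [a [u [v [fa za]]]] := elt f z; exists a; split.
    by apply: sq; rewrite fa mulrA; exact: Nr.
  by rewrite za; apply: sq; rewrite -za mulrA; exact: Nr.
have [n hn] := nilp_exp nilN.
have [|an|an] := @lift_idempotent a n; first by apply: hn; exact: Ia.
- right; have [b [_ ab]] := exp0_unit an.
  by rewrite -[y]mulr1 -ab mulrA; apply: Nr; exact: Ia.
- left; have [b [_ ab]] := exp0_unit an; rewrite opprB addrC subrK in ab.
  by rewrite -[f]mulr1 -ab mulrA; exact: Nr.
Qed.

(** Some [w] satisfies [N w != 0] and [N N w = 0]: otherwise [N w = 0] would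
    follow from [N ^ k w = 0] for every [k]. *)
Lemma nilradical_bottom : exists w,
  (exists2 n, N n & n * w <> 0) /\ forall n n', N n -> N n' -> n * (n' * w) = 0.
Proof.
apply: contrapT => no.
have kill w : (forall n n', N n -> N n' -> n * (n' * w) = 0) ->
    forall n, N n -> n * w = 0.
  by move=> hw n Nn; apply: contrapT => nw; apply: no; exists w; split=> //; exists n.
have killk k w : (forall y, products N k y -> y * w = 0) -> forall n, N n -> n * w = 0.
  elim: k w => [|k IHk] w hw; first by move=> n _; exact: hw.
  apply: kill => n n' Nn Nn'; apply: IHk => // y hy.
  by rewrite mulrA; apply: hw; exists y, n'.
have [x Nx x0] := N_neq0; have [k hk] := nilN; apply: x0.
by rewrite -[x]mulr1; apply: (killk k) => // y /hk ->; rewrite mul0r.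
Qed.

(** Outside [N], [f] divides every element of [N] inside [N], hence divides the
    [A / N]-module [N w] above; as that module is Noetherian, [1 - r f] kills a
    given element of it for some [r]. So nothing outside [N] kills a nonzero
    element, [1 - r f] is in [N], and [f] is invertible. *)
Lemma nilradical_local (f : A) : ~ N f -> isunit f.
Proof.
have div g n : ~ N g -> N n -> exists2 b, N b & n = g * b.
  move=> Ng Nn; have [a [u [v [ga na]]]] := elt g n.
  have [//|Na] : N g \/ N a by apply: nilradical_prime; rewrite ga; exact: Nr.
  have [c [_ ac]] := nilradical_unit Na.
  have nE : n = g * (v * c) by rewrite mulrA -na -mulrA ac mulr1.
  exists (v * c) => //.
  by have [//|//] : N g \/ N (v * c) by apply: nilradical_prime; rewrite -nE.
have [w [[n0 Nn0 n0w] NNw]] := nilradical_bottom.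
have stop g n : ~ N g -> N n -> exists r, (1 - r * g) * (n * w) = 0.
  move=> Ng Nn.
  have [||z [[n' Nn' zE] [k nE]] maxz] := @noetherian_maximal A A
      (fun z => (exists2 n', N n' & z = n' * w) /\ exists k, n * w = g ^+ k * z)
      (fun z => [set y | exists a, y = a * z]%classic) noethA.
  - by move=> z _; exact: lideal_principal.
  - by exists (n * w); split; [exists n|exists 0%N; rewrite expr0 mul1r].
  have [b Nb n'E] := div g n' Ng Nn'.
  have zb : z = g * (b * w) by rewrite zE n'E mulrA.
  have [|||r e] := maxz (b * w) _ _ (b * w).
  - by split; [exists b|exists k.+1; rewrite exprSr -mulrA -zb].
  - by move=> _ [a ->]; exists (a * g); rewrite -mulrA -zb.
  - by exists 1; rewrite mul1r.
  exists r; have rb : (1 - r * g) * (b * w) = 0.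
    by rewrite mulrBl mul1r -mulrA -zb -e subrr.
  rewrite nE zb [g ^+ k * _]mulrA -exprSr; set G := g ^+ k.+1.
  have -> : (1 - r * g) * (G * (b * w)) = ((1 - r * g) * G - G * (1 - r * g)) * (b * w).
    by rewrite [LHS]mulrA [RHS]mulrBl -[G * _ * _]mulrA rb mulr0 subr0.
  by apply: NNw => //; exact: commN.
have nokill g n : ~ N g -> N n -> g * (n * w) = 0 -> n * w = 0.
  move=> Ng Nn gnw; have [r] := stop g n Ng Nn.
  by rewrite mulrBl mul1r -mulrA gnw mulr0 subr0.
move=> Nf; have [r rn0] := stop f n0 Nf Nn0.
have Nrf : N (1 - r * f).
  by apply: contrapT => Nrf; apply: n0w; exact: (nokill (1 - r * f)).
have Nfr : N (1 - f * r).
  by apply: (Nsub (y := 1 - r * f)) => //; rewrite opprB addrC subrKA.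
have [a [arf _]] := nilradical_unit Nrf; have [b [_ frb]] := nilradical_unit Nfr.
rewrite opprB addrC subrK in arf; rewrite opprB addrC subrK in frb.
exists (a * r); split; first by rewrite -mulrA.
suff -> : a * r = r * b by rewrite mulrA.
by rewrite -[LHS]mulr1 -frb -!mulrA [r * (f * _)]mulrA [a * (r * f * _)]mulrA arf mul1r.
Qed.

(** * Indecomposable rings: the uniserial case *)

(** Any [p] in [N] that is not a product of two elements of [N] will do: for [x]
    in [N], either [x] is in [pA], or [p] is in [xA] and irreducibility makes the
    cofactor a unit. *)
Lemma nilradical_generator : exists p, [/\ N p, p <> 0 &
  forall x, N x -> exists y, x = p * y].
Proof.
have [p Np [N00|irr]] := nilp_irreducible idN nilN.
  by have [x Nx x0] := N_neq0; case: x0; exact: N00.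
exists p; split=> // [p0|x Nx]; first by apply: (irr 0 0) => //; rewrite mulr0.
have [a [u [v [xa pa]]]] := elt x p.
have [Na|/nilradical_local[b [_ ab]]] := pselect (N a); last first.
  by exists (u * b); rewrite mulrA -xa -mulrA ab mulr1.
have [b [_ ab]] := nilradical_unit Na.
have pE : p = x * (v * b) by rewrite mulrA -pa -mulrA ab mulr1.
have /nilradical_local[c [_ vbc]] : ~ N (v * b) by move=> Nvb; exact: (irr x (v * b)).
by exists c; rewrite pE -mulrA vbc mulr1.
Qed.

(** Let [p ^ k] be the last nonzero power; it is central. Moving [u] across
    [p ^ k] one factor at a time, as [u p = p s(u)], shows that [u] and [s ^ k (u)]
    agree modulo [N], so that [s] is surjective modulo [N] and [p u] is in
    [A p + p N]; iteration pushes the remainder into [p ^ k N = 0]. *)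
Lemma nilradical_generator_left p : N p -> p <> 0 ->
  (forall x, N x -> exists y, x = p * y) ->
  forall x, N x -> exists y, x = y * p.
Proof.
move=> Np p0 gen.
have [k [k0 pk pk1]] : exists k, [/\ (0 < k)%N, p ^+ k <> 0 & p ^+ k.+1 = 0].
  have ex : exists n, p ^+ n == 0.
    by have [n hn] := nilp_exp nilN; exists n; apply/eqP; exact: hn.
  case: (ex_minnP ex) => -[|[|k]] /eqP pn minn.
  - by move/eqP: pn; rewrite expr0 oner_eq0.
  - by case: p0; rewrite -[p]expr1.
  - by exists k.+1; split=> // /eqP /minn; rewrite ltnn.
have kill x : p ^+ k * x = 0 -> N x.
  move=> px; apply: contrapT => /nilradical_local[b [_ xb]]; apply: pk.
  by rewrite -[p ^+ k]mulr1 -xb mulrA px mul0r.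
have cpk : ring_center (p ^+ k).
  have [c [d [cc cd c0 d0 e]]] := ce pk.
  have /nilradical_local[b [bc cb]] : ~ N c.
    by move=> /gen[y cE]; apply: d0; rewrite -e cE mulrA -exprSr pk1 mul0r.
  have cB := ring_center_inv cc bc cb.
  by rewrite -[p ^+ k]mulr1 -cb mulrA e; exact: ring_centerM.
have [s sP] : exists s : A -> A, forall u, u * p = p * s u.
  by have [s sP] := choice (fun u => gen _ (NM u Np)); exists s.
have sX j u : u * p ^+ j = p ^+ j * iter j s u.
  elim: j => [|j IHj]; first by rewrite expr0 mulr1 mul1r.
  by rewrite exprSr mulrA IHj -mulrA sP mulrA.
have step u : exists v n, p * u = v * p + p * (p * n).
  have [|n e] := gen (u - iter k s u).
    by apply: kill; rewrite mulrBr (cpk u) sX subrr.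
  exists (iter k.-1 s u), n; rewrite sP -iterS prednK // -mulrDr -e.
  by rewrite addrC subrK.
have approx j u : exists v n, p * u = v * p + p ^+ j.+1 * n.
  elim: j => [|j [v [n e]]]; first by exists 0, u; rewrite mul0r add0r expr1.
  have [v' [n' e']] := step n; exists (v + p ^+ j * v'), n'.
  by rewrite e [p ^+ j.+1]exprSr -mulrA e' mulrDr addrA mulrDl !mulrA -!exprSr.
move=> x /gen[u ->]; have [v [n ->]] := approx k u; exists v.
by rewrite pk1 mul0r addr0.
Qed.

End Nilradical.

(** A nonzero central element that is not regular is nilpotent, which leads to
    the local case; there [N = pA = Ap] and [p] is nilpotent. *)
Lemma indecomposable_structure :
  ((forall x y : A, x * y = y * x) /\
   (forall x y : A, x * y = 0 -> x = 0 \/ y = 0)) \/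
  (uniserial_ring A /\ artinian_ring A).
Proof.
have [reg|/existsNP[t /not_implyP[ct /not_implyP[t0 tr]]]] :=
  pselect (forall c : A, ring_center c -> c <> 0 -> regular c).
  by left; exact: regular_center_domain.
right; have [//|nt] := central_regular_or_nilpotent ct.
have [N [idN nilN NC Nsq]] := nilradical_exists ct t0 nt.
have Nneq0 : exists2 x, N x & x <> 0.
  exists t => //; have [k tk] := nt; have : N (t ^+ k) by rewrite tk; case: idN => -[].
  elim: k {tk} => [|k IHk]; first by move/(nilradical_1 nilN).
  by rewrite exprS => /(nilradical_prime idN nilN NC Nsq)[].
have [p [Np p0 gen]] := nilradical_generator idN nilN NC Nsq Nneq0.
have genl := nilradical_generator_left idN nilN NC Nsq Nneq0 Np p0 gen.
have [n hn] := nilp_exp nilN; have pn := hn p Np.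
have local x : N x \/ isunit x.
  have [?|] := pselect (N x); [by left|right].
  exact: (nilradical_local idN nilN NC Nsq Nneq0).
have hl x : (exists v, v * x = 1) \/ (exists y, x = y * p).
  by have [/genl|[v [vx _]]] := local x; [right|left; exists v].
have hr (x : A^c) : (exists v : A^c, v * x = 1) \/ (exists y : A^c, x = y * (p : A^c)).
  by have [/gen|[v [_ xv]]] := local x; [right|left; exists v].
have pnc : (p : A^c) ^+ n = 0 by rewrite exprc.
split; split.
- exact: (power_left_uniserial pnc hr).
- exact: (power_left_uniserial pn hl).
- exact: (power_left_artinian pnc hr).
- exact: (power_left_artinian pn hl).
Qed.

End Indecomposable.

(** * Commutative distributive Noetherian domains are Dedekind *)

Section DomainStructure.
Variable A : nzRingType.
Hypotheses (commA : forall x y : A, x * y = y * x)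
  (domA : forall x y : A, x * y = 0 -> x = 0 \/ y = 0).

(** The carrier of [A] under a name that mentions the hypotheses, to which the
    structure of integral domain can be attached. *)
Definition domain_of (_ : forall x y : A, x * y = y * x)
  (_ : forall x y : A, x * y = 0 -> x = 0 \/ y = 0) : Type := A.

Local Notation D := (domain_of commA domA).

HB.instance Definition _ := GRing.NzRing.on D.
HB.instance Definition _ := GRing.PzRing_hasCommutativeMul.Build D commA.

Definition domain_unit : pred D := [pred x | `[< exists y : D, y * x = 1 >]].
Definition domain_inv (x : D) : D :=
  if pselect (exists y : D, y * x = 1) is left h then sval (cid h) else x.

Fact domain_mulV : {in domain_unit, left_inverse 1 domain_inv *%R}.
Proof.
move=> x /asboolP h; rewrite /domain_inv.
by case: pselect => // h'; case: (cid h').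
Qed.

Fact domain_unitP (x y : D) : y * x = 1 -> domain_unit x.
Proof. by move=> yx; apply/asboolP; exists y. Qed.

Fact domain_inv_out : {in [predC domain_unit], domain_inv =1 id}.
Proof.
move=> x /asboolPn nx; rewrite /domain_inv.
by case: pselect => // h; case: nx.
Qed.

HB.instance Definition _ := GRing.ComNzRing_hasMulInverse.Build D
  domain_mulV domain_unitP domain_inv_out.

Fact domain_integral (x y : D) : x * y = 0 -> (x == 0) || (y == 0).
Proof. by move/domA=> [->|->]; rewrite eqxx ?orbT. Qed.

HB.instance Definition _ := GRing.ComUnitRing_isIntegral.Build D domain_integral.

Lemma commutative_domain_dedekind :
  left_noetherian_ring A -> right_distributive_ring A ->
  commutative_dedekind_domain A.
Proof.
move=> noethA distA; pose Dom : idomainType := D.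
have noethD : left_noetherian_ring Dom by [].
have eltD : ldist Dom.
  move=> x y; have [a [u [v [xa ya]]]] := right_distributiveP distA x y.
  exists a, u, v; split; first exact: etrans (commA _ _) (etrans xa (commA _ _)).
  exact: etrans (commA _ _) (etrans ya (commA _ _)).
exists Dom; last by exists idfun; exists idfun.
split; [split=> // I idI|exact: ldist_integrally_closed|exact: ldist_primes_maximal].
apply: noethD => n; have /submoduleP[I0 ID IM] := idI n.
by apply/submoduleP; split=> // a x Ix; rewrite mulrC; exact: IM.
Qed.

End DomainStructure.

(** * The decomposition *)

(** A quotient [B] of [A] by the annihilator of a primitive central idempotent
    [e] inherits all hypotheses, and its idempotents lift to idempotents of
    [A] below [e]. *)
Lemma primitive_factor (A : nzRingType) (e : A) :
  right_distributive_ring A -> left_noetherian_ring A -> centrally_essential A ->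
  primitive e ->
  exists (B : nzRingType) (f : {rmorphism A -> B}),
  [/\ forall b, exists a, f a = b, forall x, f x = 0 <-> e * x = 0
    & [/\ uniserial_ring B, artinian_ring B & centrally_essential B]
      \/ commutative_dedekind_domain B].
Proof.
move=> distA noethA ceA [ee /eqP e0 prime].
have ce := centrally_essential_idempotent ceA ee.
have [B [f [surjf kerf]]] := corner_quotient (conj ee ce) e0.
exists B, f; split=> //.
have fe : f e = 1.
  apply/eqP; rewrite eq_sym -subr_eq0 -(rmorph1 f) -rmorphB; apply/eqP/kerf.
  by rewrite mulrBr mulr1 ee subrr.
have distB : right_distributive_ring B.
  apply/(@left_distributiveP B^c).
  exact: (@ldist_surj A^c B^c (conv_morph f) surjf (proj1 (@left_distributiveP A^c) distA)).
have noethB := left_noetherian_surj surjf noethA.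
have fcenter c : ring_center c -> ring_center (f c).
  by move=> cc b; have [a <-] := surjf b; rewrite /GRing.comm -!rmorphM (cc a).
have ceB : centrally_essential B.
  move=> b b0; have [a ab] := surjf b.
  have /ceA[c [d [cc cd c0 d0 eacd]]] : e * a <> 0.
    by move/kerf=> fa0; apply: b0; rewrite -ab.
  have fcd : b * f c = f d by rewrite -ab -eacd !rmorphM fe mul1r.
  have fd0 : f d <> 0.
    by move/kerf; rewrite -eacd !mulrA ee eacd.
  exists (f c), (f d); split=> //; [exact: fcenter|exact: fcenter|].
  by move=> fc0; apply: fd0; rewrite -fcd fc0 mulr0.
have indecB (y : B) : y * y = y -> y = 0 \/ y = 1.
  move=> yy; have [x xy] := surjf y; pose g := e * x.
  have gy : f g = y by rewrite rmorphM fe mul1r.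
  have eg : e * g = g by rewrite mulrA ee.
  have gg : g * g = g.
    have : f (g * g - g) = 0 by rewrite rmorphB rmorphM gy yy subrr.
    move/kerf; rewrite mulrBr mulrA eg => /eqP.
    by rewrite subr_eq0 => /eqP.
  have [|g0|g1] := prime g gg; first by rewrite -(ce g).
    by left; rewrite -gy g0 rmorph0.
  by right; rewrite -gy g1.
have [[commB domB]|[uniB artB]] := indecomposable_structure noethB ceB
  (right_distributiveP distB) indecB; last by left; split.
by right; exact: commutative_domain_dedekind.
Qed.

Lemma decomposition (A : nzRingType) :
  right_distributive_ring A -> left_noetherian_ring A -> centrally_essential A ->
  exists n : nat, (0 < n)%N /\
    exists B : 'I_n -> nzRingType, ring_product A B /\
    forall i : 'I_n,
      [/\ uniserial_ring (B i), artinian_ring (B i) & centrally_essential (B i)]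
      \/ commutative_dedekind_domain (B i).
Proof.
move=> distA noethA ceA.
have [s [prims orths sums]] := idempotent_decomposition ceA noethA.
exists (size s); split.
  by case: s sums {prims orths} => //; rewrite big_nil => /esym/eqP; rewrite oner_eq0.
pose e (i : 'I_(size s)) := tnth (in_tuple s) i.
have prim i : primitive (e i) by apply: prims; exact: mem_tnth.
have sume : \sum_i e i = 1.
  by rewrite -sums [RHS](big_tnth _ _ s).
have orth i j : i != j -> e i * e j = 0.
  have lt (k l : 'I_(size s)) : (k < l)%N -> e k * e l = 0.
    move=> kl; apply/eqP; rewrite /e !(tnth_nth 0) /=.
    by move/(pairwiseP 0): orths => /(_ k l); apply; rewrite ?inE.
  rewrite neq_ltn => /orP[/lt //|/lt]; have [ee _ _] := prim i.
  by rewrite (centrally_essential_idempotent ceA ee).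
have factor i := primitive_factor distA noethA ceA (prim i).
pose B i := projT1 (cid (factor i)).
have ff i := projT2 (cid (factor i)).
pose f i : {rmorphism A -> B i} := projT1 (cid (ff i)).
have fP i := projT2 (cid (ff i)).
exists B; split; last by move=> i; case: (fP i).
exists f.
have surjf i b : exists a, f i a = b by case: (fP i).
have kerf i x : f i x = 0 <-> e i * x = 0 by case: (fP i).
pose g (h : forall i, B i) : A := \sum_i e i * projT1 (cid (surjf i (h i))).
have fg h i : f i (g h) = h i.
  rewrite rmorph_sum (bigD1 i) //= big1 ?addr0 => [|j ji].
    case: cid => a /= <-; apply/eqP; rewrite -subr_eq0 -rmorphB; apply/eqP/kerf.
    by have [ee _ _] := prim i; rewrite mulrBr mulrA ee subrr.
  by apply/kerf; rewrite mulrA orth 1?eq_sym // mul0r.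
exists g => [a|h]; last by apply: functional_extensionality_dep => i; exact: fg.
rewrite -[RHS]mul1r -sume mulr_suml; apply: eq_bigr => i _.
case: cid => b /= ba; apply/eqP; rewrite -subr_eq0 -mulrBr; apply/eqP/kerf.
by rewrite rmorphB ba subrr.
Qed.

Theorem proposition2p8 (A : nzRingType) :
  ([/\ right_distributive_ring A, left_noetherian_ring A & centrally_essential A] <->
   exists n : nat, (0 < n)%N /\
     exists B : 'I_n -> nzRingType,
       ring_product A B /\
       forall i : 'I_n,
         [/\ uniserial_ring (B i), artinian_ring (B i)
           & centrally_essential (B i)]
         \/ commutative_dedekind_domain (B i)) /\
  ([/\ right_distributive_ring A, left_noetherian_ring A & centrally_essential A] ->
   distributive_ring A /\ noetherian_ring A).
Proof.
have back n (B : 'I_n -> nzRingType) : ring_product A B -> (forall i : 'I_n,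
    [/\ uniserial_ring (B i), artinian_ring (B i) & centrally_essential (B i)]
    \/ commutative_dedekind_domain (B i)) ->
    [/\ distributive_ring A, noetherian_ring A & centrally_essential A].
  by move=> prodA hB; apply: (product_properties prodA) => i; exact: factor_properties.
split=> [|[distA noethA ceA]].
  split=> [[distA noethA ceA]|[n [_ [B [prodA hB]]]]]; first exact: decomposition.
  by have [[distR _] [_ noethL] ce] := back n B prodA hB; split.
have [n [_ [B [prodA hB]]]] := decomposition distA noethA ceA.
by have [dist noeth _] := back n B prodA hB; split.
Qed.
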